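(* Let $X$ be a random variable with values in $\mathbb{N}_0$ and let $P_\lambda$ be a Poisson random variable with mean $\lambda\in(0,\infty)$. Let $Z$ be a random variable defined on the same probability space as $X$ with values in $\mathbb{Z}$, and let $(q_i)_{i\in\mathbb{N}_0}$ be the sequence given by $$ q_{i-1}=i\,\mathbb{P}(X=i)-\lambda\,\mathbb{P}(X+Z=i-1),\qquad i\in\mathbb{N}. $$ Then $$ d_{TV}(X,P_\lambda)\le(1\wedge\lambda)\mathbb{E}[|Z|]+\Big(1\wedge\frac{1}{\sqrt\lambda}\Big)\sum_{i=0}^\infty|q_i| \qquad\text{and}\qquad d_W(X,P_\lambda)\le\lambda\,\mathbb{E}[|Z|]+\sum_{i=0}^\infty|q_i|. $$ Moreover, if $\mathbb{P}(X+Z\ge 0)=1$, then $$ d_W(X,P_\lambda)\le(1.1437\sqrt\lambda\wedge\lambda)\,\mathbb{E}[|Z|]+\sum_{i=0}^\infty|q_i|; $$ for all $m\in\mathbb{N}_0$, $$ |\mathbb{P}(X=0)-\mathbb{P}(P_\lambda=0)|\le\frac{m!}{\lambda^m}\mathbb{E}[|Z|]+\sum_{k=0}^{m-1}\Big(\frac{\lambda}{k+1}\wedge\frac{k!}{\lambda^k}\Big)\mathbb{E}\big[|Z|\mathbf{1}\{X-Z_-=k\}\big]+\Big(1\wedge\frac1\lambda\Big)|q_0|+\Big(1\wedge\frac1{\lambda^2}\Big)\sum_{i=1}^\infty|q_i|; $$ and for all $v\in\mathbb{N}$, $$ |\mathbb{P}(X\le v)-\mathbb{P}(P_\lambda\le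 v)|\le\frac{(v+1)^2}{\lambda}\mathbb{E}[|Z|]+\mathbb{E}\big[|Z|\mathbf{1}\{X-Z_-\le v\}\big]+\Big(1\wedge\frac1{\sqrt\lambda}\Big)\sum_{i=0}^\infty|q_i|. $$
   Context: $\mathbb{N}=\{1,2,\dots\}$, $\mathbb{N}_0=\mathbb{N}\cup\{0\}$, $a\wedge b=\min\{a,b\}$, and $W_+=\max\{W,0\}$, $W_-=\max\{-W,0\}$ are the positive and negative parts of a random variable $W$. For $\mathbb{N}_0$-valued $X$ the total variation distance is $d_{TV}(X,P_\lambda)=\sup_{A\subset\mathbb{N}_0}|\mathbb{P}(X\in A)-\mathbb{P}(P_\lambda\in A)|$ and the Wasserstein distance is $d_W(X,P_\lambda)=\sup_{g\in\mathrm{Lip}(1)}|\mathbb{E}[g(X)]-\mathbb{E}[g(P_\lambda)]|$, where $\mathrm{Lip}(1)$ is the set of Lipschitz functions $g:\mathbb{N}_0\to\mathbb{R}$ with Lipschitz constant at most $1$. An empty sum is $0$. Right-hand sides may equal $+\infty$, in which case the corresponding inequality is regarded as trivially true (in particular the Wasserstein bounds are only claimed when their right-hand side is finite). *)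

(* Defs.v *)
From HB Require Import structures.
From mathcomp Require Import all_boot all_order all_algebra.
From mathcomp Require Import all_classical all_reals all_analysis.

Set Implicit Arguments.
Unset Strict Implicit.
Unset Printing Implicit Defensive.

Import Order.TTheory GRing.Theory Num.Theory.

Local Open Scope classical_set_scope.
Local Open Scope ring_scope.

(* mathcomp-analysis equips nat, but not int, with the discrete sigma-algebra. *)
HB.instance Definition _ := isPointed.Build int 0.
HB.instance Definition _ := @isMeasurable.Build default_measure_display
  int discrete_measurable discrete_measurable0
  discrete_measurableC discrete_measurableU.

Definition is_poisson (d : measure_display) (T : measurableType d)
    (R : realType) (P : probability T R) (lambda : R)
    (Y : {RV P >-> nat}) : Prop :=
  (* the second argument of poisson_prob is unused in its definition *)
  forall A : set nat, distribution P Y A = poisson_prob lambda 0%N A.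

(* The two random variables may live on different probability spaces. *)
Definition dTV (d d' : measure_display) (T : measurableType d)
    (T' : measurableType d') (R : realType)
    (P : probability T R) (X : {RV P >-> nat})
    (Q : probability T' R) (Y : {RV Q >-> nat}) : \bar R :=
  ereal_sup [set `|P (X @^-1` A) - Q (Y @^-1` A)|%E | A in [set: set nat]].

Definition Lip1 (R : realType) : set (nat -> R) :=
  [set g | forall i j : nat, `|g i - g j| <= `|i%:R - j%:R|].

(* If some g in Lip1 is not integrable, the expectations below are only the
   conventional values of the extended integral. In the bounds on dW this can
   happen only when the right-hand side is +oo. *)
Definition dW (d d' : measure_display) (T : measurableType d)
    (T' : measurableType d') (R : realType)
    (P : probability T R) (X : {RV P >-> nat})
    (Q : probability T' R) (Y : {RV Q >-> nat}) : \bar R :=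
  ereal_sup [set `|'E_P[g \o X] - 'E_Q[g \o Y]|%E | g in @Lip1 R].

Definition negpart (z : int) : int := Num.max (- z) 0.

Arguments dTV {d d' T T' R} P X Q Y.
Arguments dW {d d' T T' R} P X Q Y.
Arguments is_poisson {d T R} P lambda Y.

(* Main.v *)
Require Import Defs.
From mathcomp Require Import all_boot all_order all_algebra.
From mathcomp Require Import all_classical all_reals all_analysis.
From mathcomp Require Import measurable_realfun.
From mathcomp Require Import ring lra zify.

Import Order.TTheory GRing.Theory Num.Theory.
Import numFieldNormedType.Exports.

Local Open Scope classical_set_scope.
Local Open Scope ring_scope.

(** The argument is the Chen-Stein method.  For a test function [g] with Poisson
    mean [c], the Stein equation [lam f(k+1) - k f(k) = g(k) - c] has a solution
    [f] with [f 0 = 0].  Taking the expectation at [X] and replacing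
    [i P(X = i)] by [q_(i-1) + lam P(X + Z = i - 1)] gives ([stein_identity])
<<
    E g(X) - c = lam E [f(X + 1) - f(X + Z + 1)] - sum_i q_i f(i + 1),
>>
    where [f] is zero on negative integers.  So [|E g(X) - c|] is at most
    [lam sup |f(k+1) - f(k)| E|Z| + sup |f| sum |q_i|], and the theorem is a list
    of bounds on [f] and its increments.  If [sum |q_i|] is finite then so is
    [E X], hence every Lipschitz function of [X] is integrable; if it is infinite
    there is nothing to prove.

    To bound [f], fix [m] and let [p], [F], [T] be the Poisson probabilities of
    [m], of [0..m] and of the integers beyond [m], and [a], [b] the means of
    [(m + 1 - Y)_+] and [(Y - m - 1)_+] for a Poisson [Y].  Then
    [T a + F b = lam p] ([excess_balance]).  If [A] and [B] are the contributions
    of the two ranges to the mean of [g - g(m + 1)], then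
    [lam p f(m + 1) = T A - F B] and
    [lam^2 p (f(m + 2) - f(m + 1)) = - (A b + B a)].  For a Lipschitz [g], one has
    [|A| <= a] and [|B| <= b], so that [|f| <= 1] and the increments are at most
    [2 a b / (lam^2 p)].  For an indicator, [f] is at most [F T / (lam p)] and the
    increments are at most the minimum of [1] and [1 / lam].

    It remains to prove [2 a b <= lam^(3/2) p] and [F T <= lam^(1/2) p].  Both
    come from log-concavity of the Poisson weights.  A log-concave sequence
    satisfies a first-moment and a second-moment inequality
    ([logconcave_first_moment], [logconcave_second_moment]); applied to the
    weights above and below [m], the first pair gives [a b <= lam T F], the second
    [lam T F <= 2 a b].  Each is then combined with
    [4 (T a) (F b) <= (T a + F b)^2 = (lam p)^2].  The increments for Lipschitz
    functions are thus at most [1 / sqrt lam], and [1.1437 / sqrt lam] follows.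
    For [lam <= 1] a direct estimate gives [2 a b <= lam^2 p].

    For the events [Y = 0] and [Y <= v] the solution is explicit to the right of
    the event, where it is positive and decreasing; this gives the last two
    bounds, in which the increment is estimated according to the smaller
    argument [X - Z_-] of the two. *)

(** * Log-concave sequences and their moments *)

Section Limits.
Set Implicit Arguments.
Context {R : realType}.

Lemma ler_limit (u v : nat -> R) (a b : R) :
  u @ \oo --> a -> v @ \oo --> b -> (forall n, u n <= v n) -> a <= b.
Proof.
move=> ua vb uv; rewrite -(cvg_lim (@Rhausdorff R) ua) -(cvg_lim (@Rhausdorff R) vb).
by apply: ler_lim; [exact: cvgP ua|exact: cvgP vb|exact: nearW].
Qed.

End Limits.

Section LogConcave.
Set Implicit Arguments.
Context {R : realType}.
Implicit Types (u v : nat -> R) (N : nat).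

Definition tail_sum u N m : R := \sum_(m <= k < N) u k.

Lemma tail_sumS u N m : (m < N)%N -> tail_sum u N m.+1 = tail_sum u N m - u m.
Proof. by move=> mN; rewrite /tail_sum (big_ltn mN) addrC addKr. Qed.

Lemma sum_tail_sum u N :
  \sum_(0 <= m < N) tail_sum u N m = \sum_(0 <= k < N) k.+1%:R * u k.
Proof.
elim: N => [|N IH]; first by rewrite !big_geq.
rewrite [RHS]big_nat_recr //= -IH.
rewrite (eq_big_nat _ _ (F2 := fun m => tail_sum u N m + u N)); last first.
  by move=> m /andP[_ mN]; rewrite /tail_sum big_nat_recr.
rewrite big_split /= sumr_const_nat subn0 mulr_natl; congr (_ + _).
by rewrite big_nat_recr //= {2}/tail_sum [X in _ + X]big_geq // addr0.
Qed.

Lemma first_moment_tail_sum u N :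
  \sum_(0 <= m < N) m.+1%:R * tail_sum u N m =
  \sum_(0 <= k < N) (k.+1 * k.+2)%N%:R / 2 * u k.
Proof.
elim: N => [|N IH]; first by rewrite !big_geq.
rewrite [RHS]big_nat_recr //= -IH.
rewrite (eq_big_nat _ _ (F2 := fun m => m.+1%:R * tail_sum u N m + m.+1%:R * u N));
  last first.
  by move=> m /andP[_ mN]; rewrite /tail_sum big_nat_recr //= mulrDr.
rewrite big_split /=; congr (_ + _).
  by rewrite big_nat_recr //= {2}/tail_sum [X in _ + _ * X]big_geq // mulr0 addr0.
rewrite -mulr_suml; congr (_ * _).
elim: (N) => [|n IHn]; first by rewrite big_nat1; field.
by rewrite big_nat_recr //= IHn; field.
Qed.

(** The square contains every product [v m * v l] with [m + l < N], and the
    hypothesis bounds [v 0 * v (m + l)] by it; the value [v k] is met once for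
    each of the [k + 1] ways of writing [k = m + l]. *)
Lemma first_moment_of_submultiplicative v N :
  (forall k, 0 <= v k) ->
  (forall m l, (m + l < N)%N -> v 0%N * v (m + l)%N <= v m * v l) ->
  v 0%N * \sum_(0 <= k < N) k.+1%:R * v k <= (\sum_(0 <= k < N) v k) ^+ 2.
Proof.
move=> v0 vM.
rewrite -sum_tail_sum mulr_sumr expr2 mulr_suml.
apply: ler_sum_nat => m /andP[_ mN].
rewrite [leRHS]mulr_sumr [leRHS](big_cat_nat (n := N - m)) ?leq_subr//=.
rewrite -[leLHS]addr0 lerD//; last first.
  by apply: sumr_ge0 => l _; rewrite mulr_ge0.
rewrite /tail_sum -{1}[m]add0n big_addn mulr_sumr.
apply: ler_sum_nat => l /andP[_ lN].
by rewrite addnC; apply: vM; lia.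
Qed.

(** The ratios [v l.+1 / v l] decrease, so the ratios starting at [m] are
    dominated one by one by the ratios starting at [0].  A zero of [v] makes all
    later terms vanish (or [v 0] itself), and is treated apart. *)
Lemma logconcave_submultiplicative v N :
  (forall k, 0 <= v k) ->
  (forall j k, (j <= k)%N -> (k.+1 < N)%N -> v j * v k.+1 <= v j.+1 * v k) ->
  forall m l, (m + l < N)%N -> v 0%N * v (m + l)%N <= v m * v l.
Proof.
move=> v0 lc m l; rewrite [v m * _]mulrC; elim: l => [|l IH] mlN.
  by rewrite addn0.
have {}IH := IH ltac:(lia).
have step := lc l (m + l)%N ltac:(lia) ltac:(lia).
have no_jump := lc 0%N (m + l)%N ltac:(lia) ltac:(lia).
rewrite addnS.
have [vl0|vl_neq0] := eqVneq (v l) 0.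
  have vml0 : v 0%N * v (m + l)%N = 0.
    by apply/eqP; rewrite eq_le mulr_ge0// (le_trans IH)// vl0 mul0r.
  move/eqP: vml0; rewrite mulf_eq0 => /orP[] /eqP E.
    by rewrite E mul0r mulr_ge0.
  by rewrite (le_trans no_jump)// E mulr0 mulr_ge0.
have vl_gt0 : 0 < v l by rewrite lt_def vl_neq0 v0.
rewrite -(ler_pM2l vl_gt0).
have H1 := ler_wpM2l (v0 0%N) step.
have H2 := ler_wpM2l (v0 l.+1) IH.
by apply: le_trans (le_trans H1 _); [lra|move: H2; lra].
Qed.

(** Decreasing ratios written as cross products, so that zeros are harmless; the
    cut at [N] lets it speak of a finite stretch of a sequence read in either
    direction. *)
Definition logconcave u N :=
  forall j k l, (j <= k)%N -> (k + l < N)%N -> u j * u (k + l)%N <= u (j + l)%N * u k.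

Lemma logconcave_first_moment u N : (forall k, 0 <= u k) -> logconcave u N ->
  u 0%N * \sum_(0 <= k < N) k.+1%:R * u k <= (\sum_(0 <= k < N) u k) ^+ 2.
Proof.
move=> u0 lc; apply: first_moment_of_submultiplicative => // m l mlN.
by rewrite [leRHS]mulrC; exact: (lc 0%N m l isT mlN).
Qed.

(** The tail sums of a log-concave sequence are log-concave, and this is the
    first-moment inequality for them: summing tails once gives the first moment,
    summing them with weights [m + 1] gives the second.  Equality holds in the
    limit [N -> oo] for geometric sequences. *)
Lemma logconcave_second_moment u N : (forall k, 0 <= u k) -> logconcave u N ->
  (\sum_(0 <= k < N) u k) * (\sum_(0 <= k < N) (k.+1 * k.+2)%N%:R / 2 * u k)
  <= (\sum_(0 <= k < N) k.+1%:R * u k) ^+ 2.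
Proof.
move=> u0 lc; rewrite -sum_tail_sum -first_moment_tail_sum.
have U0 k : 0 <= tail_sum u N k by apply: sumr_ge0.
have hazard j k : (j <= k)%N -> (k < N)%N -> u j * tail_sum u N k <= tail_sum u N j * u k.
  move=> jk kN; rewrite {2}/tail_sum.
  rewrite (big_cat_nat (n := N - k + j)) //=; [|lia|lia].
  rewrite mulrDl -[leLHS]addr0 lerD//; last first.
    by apply: mulr_ge0 => //; apply: sumr_ge0.
  rewrite /tail_sum -{1}[k]add0n big_addn -{2}[j]add0n big_addn.
  rewrite addnK mulr_sumr mulr_suml.
  apply: ler_sum_nat => l /andP[_ lN]; rewrite addnC [(l + j)%N]addnC.
  by apply: lc; lia.
apply: first_moment_of_submultiplicative => //.
apply: logconcave_submultiplicative => // j k jk kN.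
rewrite !tail_sumS; [|lia|lia].
by have := hazard j k jk ltac:(lia); lra.
Qed.

End LogConcave.

(** * Poisson weights, tails and mean excesses *)

Section Poisson.
Set Implicit Arguments.
Context {R : realType}.
Variable lam : R.
Hypothesis lam_gt0 : 0 < lam.

Local Notation p := (poisson_pmf lam).

Lemma poisson_pmfE k : p k = expR (- lam) * exp_coeff lam k.
Proof. by rewrite /poisson_pmf lam_gt0 mulrC. Qed.

Lemma poisson_pmf_gt0 k : 0 < p k.
Proof.
by rewrite poisson_pmfE mulr_gt0 ?expR_gt0// divr_gt0// ?exprn_gt0// ltr0n fact_gt0.
Qed.

Lemma poisson_pmfS k : k.+1%:R * p k.+1 = lam * p k.
Proof.
rewrite !poisson_pmfE /exp_coeff /= factS natrM exprS.
have k0 : (k`!%:R : R) != 0 by rewrite pnatr_eq0 -lt0n fact_gt0.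
have k1 : (k%:R + 1 : R) != 0 by rewrite natr1 pnatr_eq0.
by field; rewrite k0 addrC.
Qed.

Lemma poisson_pmf_logconcave j k l : (j <= k)%N -> p j * p (k + l)%N <= p (j + l)%N * p k.
Proof.
move=> jk; elim: l => [|l IH]; first by rewrite !addn0.
rewrite !addnS.
have E1 := poisson_pmfS (j + l); have E2 := poisson_pmfS (k + l).
have c1 : 0 < ((j + l).+1%:R : R) by [].
have c2 : 0 < ((k + l).+1%:R : R) by [].
rewrite -(ler_pM2l c1) -(ler_pM2l c2).
have -> : (k + l).+1%:R * ((j + l).+1%:R * (p j * p (k + l).+1)) =
  (j + l).+1%:R * lam * (p j * p (k + l)%N).
  transitivity ((j + l).+1%:R * p j * ((k + l).+1%:R * p (k + l).+1)); first by ring.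
  by rewrite E2; ring.
have -> : (k + l).+1%:R * ((j + l).+1%:R * (p (j + l).+1 * p k)) =
  (k + l).+1%:R * lam * (p (j + l)%N * p k).
  transitivity ((k + l).+1%:R * p k * ((j + l).+1%:R * p (j + l).+1)); first by ring.
  by rewrite E1; ring.
have : ((j + l).+1%:R : R) <= (k + l).+1%:R by rewrite ler_nat ltnS leq_add2r.
move=> cc; apply: ler_pM => //; rewrite ?mulr_ge0 ?poisson_pmf_ge0 ?(ltW lam_gt0)//.
by rewrite ler_pM2r.
Qed.

Lemma poisson_pmf_sum_cvg : (fun N => \sum_(0 <= k < N) p k) @ \oo --> (1 : R).
Proof.
have -> : (1 : R) = expR (- lam) * expR lam by rewrite expRN mulVf ?gt_eqF ?expR_gt0.
rewrite (_ : (fun N => _) = (fun N => expR (- lam) * series (exp_coeff lam) N)).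
  by apply: cvgM; [exact: cvg_cst|exact: is_cvg_series_exp_coeff].
by apply/funext => N; rewrite /series /= mulr_sumr; apply: eq_bigr => k _;
  rewrite poisson_pmfE.
Qed.

Lemma poisson_pmf_cvg0 : p @ \oo --> (0 : R).
Proof. by apply: cvg_series_cvg_0; exact: (cvgP _ poisson_pmf_sum_cvg). Qed.

(** The mean is the limit of partial sums in the natural order: this is what
    finite identities between the weights produce. *)
Definition has_poisson_mean (h : nat -> R) (c : R) :=
  (fun N => \sum_(0 <= k < N) p k * h k) @ \oo --> c.

Lemma has_poisson_mean_cst (a : R) : has_poisson_mean (fun=> a) a.
Proof.
rewrite /has_poisson_mean -[X in _ --> X]mul1r.
under eq_fun do rewrite -mulr_suml.
by apply: cvgM; [exact: poisson_pmf_sum_cvg|exact: cvg_cst].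
Qed.

Lemma has_poisson_meanD g h c e : has_poisson_mean g c -> has_poisson_mean h e ->
  has_poisson_mean (fun k => g k + h k) (c + e).
Proof.
move=> gc he; rewrite /has_poisson_mean.
under eq_fun do [under eq_bigr do rewrite mulrDr; rewrite big_split /=].
exact: cvgD.
Qed.

Lemma has_poisson_meanZ a h c : has_poisson_mean h c ->
  has_poisson_mean (fun k => a * h k) (a * c).
Proof.
move=> hc; rewrite /has_poisson_mean.
under eq_fun do [under eq_bigr do rewrite mulrCA; rewrite -mulr_sumr].
by apply: cvgM => //; exact: cvg_cst.
Qed.

Lemma poisson_pmf_sum_id m :
  \sum_(0 <= k < m.+1) p k * k%:R = lam * \sum_(0 <= k < m.+1) p k - lam * p m.
Proof.
elim: m => [|m IH]; first by rewrite !big_nat1 mulr0 subrr.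
rewrite big_nat_recr //= IH [in RHS]big_nat_recr //= mulrC.
by have := poisson_pmfS m; lra.
Qed.

Lemma poisson_pmf_sum_sqr m :
  \sum_(0 <= k < m.+1) p k * (k%:R * (k%:R - 1)) =
  lam ^+ 2 * \sum_(0 <= k < m.+1) p k - lam ^+ 2 * p m - lam * m%:R * p m.
Proof.
elim: m => [|m IH]; first by rewrite !big_nat1; ring.
rewrite big_nat_recr //= IH [in RHS]big_nat_recr //=.
have E := poisson_pmfS m; rewrite -natr1 in E *.
have -> : p m.+1 * ((m%:R + 1) * (m%:R + 1 - 1)) = lam * p m * m%:R.
  by rewrite -E; ring.
have : lam * ((m%:R + 1) * p m.+1) = lam * (lam * p m) by rewrite E.
by lra.
Qed.

Lemma has_poisson_mean_id : has_poisson_mean (fun k => k%:R) lam.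
Proof.
rewrite /has_poisson_mean -cvg_shiftS /=.
under eq_fun do rewrite poisson_pmf_sum_id.
have F1 : (fun m => \sum_(0 <= k < m.+1) p k) @ \oo --> (1 : R).
  by rewrite (cvg_shiftS (fun n => \sum_(0 <= k < n) p k)); exact: poisson_pmf_sum_cvg.
suff : (fun m => lam * \sum_(0 <= k < m.+1) p k - lam * p m) @ \oo --> lam * 1 - lam * 0.
  by rewrite mulr1 mulr0 subr0.
by apply: cvgB; apply: cvgM => //; try exact: cvg_cst; exact: poisson_pmf_cvg0.
Qed.

Lemma has_poisson_mean_sqr : has_poisson_mean (fun k => k%:R * (k%:R - 1)) (lam ^+ 2).
Proof.
rewrite /has_poisson_mean -cvg_shiftS /=.
under eq_fun do rewrite poisson_pmf_sum_sqr.
have F1 : (fun m => \sum_(0 <= k < m.+1) p k) @ \oo --> (1 : R).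
  by rewrite (cvg_shiftS (fun n => \sum_(0 <= k < n) p k)); exact: poisson_pmf_sum_cvg.
have G0 : (fun m => m%:R * p m) @ \oo --> (0 : R).
  rewrite -cvg_shiftS /=; under eq_fun do rewrite poisson_pmfS.
  suff : (fun m => lam * p m) @ \oo --> lam * 0 by rewrite mulr0.
  by apply: cvgM; [exact: cvg_cst|exact: poisson_pmf_cvg0].
suff : (fun m => lam ^+ 2 * \sum_(0 <=
  k < m.+1) p k - lam ^+ 2 * p m - lam * (m%:R * p m)) @ \oo
    --> lam ^+ 2 * 1 - lam ^+ 2 * 0 - lam * 0.
  by rewrite mulr1 !mulr0 !subr0; under eq_fun do rewrite mulrA.
apply: cvgB; [apply: cvgB|]; apply: cvgM => //; try exact: cvg_cst; exact: poisson_pmf_cvg0.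
Qed.

Lemma has_poisson_mean_tail h c n : has_poisson_mean h c ->
  (fun N => \sum_(0 <= k < N) p (n + k)%N * h (n + k)%N) @ \oo -->
  c - \sum_(0 <= k < n) p k * h k.
Proof.
rewrite /has_poisson_mean -(cvg_shiftn n) /= => hc.
have -> : (fun N => \sum_(0 <= k < N) p (n + k)%N * h (n + k)%N) =
  (fun N => \sum_(0 <= k < N + n) p k * h k - \sum_(0 <= k < n) p k * h k).
  apply/funext => N; rewrite [in RHS](big_cat_nat (n := n)) ?leq_addl//=.
  rewrite [RHS]addrAC subrr add0r.
  transitivity (\sum_(0 + n <= k < N + n) p k * h k); last by rewrite add0n.
  rewrite big_addn addnK.
  by apply: eq_bigr => k _; rewrite addnC.
by apply: cvgB => //; exact: cvg_cst.
Qed.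

Definition poisson_cdf m := \sum_(0 <= k < m.+1) p k.
Definition poisson_ccdf m := 1 - poisson_cdf m.
(** For [Y] Poisson, these are the means of [(m + 1 - Y)_+] and of
    [(Y - m - 1)_+]; the closed forms follow from [k p_k = lam p_(k-1)]. *)
Definition lower_excess m := lam * p m + (m.+1%:R - lam) * poisson_cdf m.
Definition upper_excess m := lam * p m - (m.+1%:R - lam) * poisson_ccdf m.

Lemma poisson_cdfS m : poisson_cdf m.+1 = poisson_cdf m + p m.+1.
Proof. by rewrite /poisson_cdf big_nat_recr. Qed.

Lemma lower_excessE m : lower_excess m = \sum_(0 <= k < m.+1) (m.+1 - k)%:R * p k.
Proof.
rewrite /lower_excess (eq_big_nat _ _ (F2 := fun k => m.+1%:R * p k - p k * k%:R)).
  by rewrite sumrB -mulr_sumr poisson_pmf_sum_id /poisson_cdf; ring.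
by move=> k /andP[_ km]; rewrite natrB 1?ltnW//; ring.
Qed.

Lemma upper_excess_cvg m :
  (fun N => \sum_(0 <= k < N) k%:R * p (m.+1 + k)%N) @ \oo --> upper_excess m.
Proof.
have H : has_poisson_mean (fun k => k%:R + - m.+1%:R) (lam - m.+1%:R).
  by apply: has_poisson_meanD; [exact: has_poisson_mean_id|exact: has_poisson_mean_cst].
have := has_poisson_mean_tail m.+1 H.
have -> : lam - m.+1%:R - \sum_(0 <= k < m.+1) p k * (k%:R - m.+1%:R) = upper_excess m.
  under eq_bigr do rewrite mulrBr.
  by rewrite sumrB poisson_pmf_sum_id -mulr_suml /upper_excess /poisson_ccdf
    /poisson_cdf; ring.
by under eq_fun do [under eq_bigr => k _ do rewrite natrD addrC addKr mulrC].
Qed.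

Lemma poisson_ccdf_cvg m : (fun N => \sum_(0 <= k < N) p (m.+1 + k)%N) @ \oo -->
  poisson_ccdf m.
Proof.
have := has_poisson_mean_tail m.+1 (@has_poisson_mean_cst 1).
rewrite -mulr_suml mulr1 -/(poisson_ccdf m).
by under eq_fun do [under eq_bigr => k _ do rewrite mulr1].
Qed.

Lemma poisson_cdf_ge0 m : 0 <= poisson_cdf m.
Proof. by apply: sumr_ge0 => k _; exact: poisson_pmf_ge0. Qed.

Lemma poisson_ccdf_ge0 m : 0 <= poisson_ccdf m.
Proof.
apply: (ler_limit (cvg_cst 0) (poisson_ccdf_cvg m)) => n.
by apply: sumr_ge0 => k _; exact: poisson_pmf_ge0.
Qed.

Lemma upper_excess_ge0 m : 0 <= upper_excess m.
Proof.
apply: (ler_limit (cvg_cst 0) (upper_excess_cvg m)) => n.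
by apply: sumr_ge0 => k _; rewrite mulr_ge0// poisson_pmf_ge0.
Qed.

Lemma poisson_cdf_le_lower_excess m : poisson_cdf m <= lower_excess m.
Proof.
rewrite lower_excessE; apply: ler_sum_nat => k /andP[_ km].
by rewrite ler_peMl ?poisson_pmf_ge0// ler1n subn_gt0.
Qed.

(** This balance turns estimates of the two excesses into estimates by the
    single weight [p m]; it is the source of every bound on the Stein solution. *)
Lemma excess_balance m : poisson_ccdf m * lower_excess m
  + poisson_cdf m * upper_excess m = lam * p m.
Proof. by rewrite /lower_excess /upper_excess /poisson_ccdf; ring. Qed.

(** Log-concavity of the weights, summed over [l]: the ratio of the tail beyond
    [k] to the weight at [k] decreases with [k]. *)
Lemma poisson_hazard_nondec j k : (j <= k)%N ->
  p j * poisson_ccdf k <= poisson_ccdf j * p k.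
Proof.
move=> jk.
have H1 : (fun N => p j * \sum_(0 <= l < N) p (k.+1 + l)%N) @ \oo --> p j * poisson_ccdf k.
  by apply: cvgM; [exact: cvg_cst|exact: poisson_ccdf_cvg].
have H2 : (fun N => \sum_(0 <= l < N) p (j.+1 + l)%N * p k) @ \oo --> poisson_ccdf j * p k.
  under eq_fun do rewrite -mulr_suml.
  by apply: cvgM; [exact: poisson_ccdf_cvg|exact: cvg_cst].
apply: (ler_limit H1 H2) => n.
rewrite mulr_sumr; apply: ler_sum => l _.
by rewrite !addSnnS poisson_pmf_logconcave.
Qed.

Let p_ge0 := poisson_pmf_ge0 lam.

(** Reading the weights downwards from [m] preserves log-concavity; hence each
    moment inequality comes in an upper and a lower version. *)
Lemma reversed_logconcave m : logconcave (fun k => p (m - k)%N) m.+1.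
Proof.
move=> j k l jk klm.
have := @poisson_pmf_logconcave (m - (k + l)) (m - (k + l) + (k - j)) l ltac:(lia).
rewrite mulrC [leRHS]mulrC.
by congr (p _ * p _ <= p _ * p _); lia.
Qed.

Lemma shifted_logconcave n N : logconcave (fun k => p (n + k)%N) N.
Proof.
move=> j k l jk _; rewrite !addnA; apply: poisson_pmf_logconcave => //.
by rewrite leq_add2l.
Qed.

Lemma reversed_sum m : \sum_(0 <= k < m.+1) p (m - k)%N = poisson_cdf m.
Proof. by rewrite big_nat_rev /=; apply: eq_big_nat => k /andP[_ km]; congr p; lia. Qed.

Lemma reversed_first_moment m :
  \sum_(0 <= k < m.+1) k.+1%:R * p (m - k)%N = lower_excess m.
Proof.
rewrite lower_excessE big_nat_rev /=; apply: eq_big_nat => k /andP[_ km].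
by congr (_%:R * p _); lia.
Qed.

Lemma reversed_second_moment m :
  \sum_(0 <= k < m.+1) (k.+1 * k.+2)%N%:R / 2 * p (m - k)%N =
  (lam * poisson_cdf m + (m.+2%:R - lam) * lower_excess m) / 2.
Proof.
rewrite big_nat_rev /= (eq_big_nat _ _ (F2 := fun k => 2^-1 * (m.+1%:R * m.+2%:R * p k
   + - (2 * m.+1%:R) * (p k * k%:R) + p k * (k%:R * (k%:R - 1))))); last first.
  move=> k /andP[_ km]; rewrite add0n subSS.
  have -> : (m - (m - k) = k)%N by lia.
  have -> : (((m - k).+1 * (m - k).+2)%N%:R : R) =
      (m%:R - k%:R + 1) * (m%:R - k%:R + 2).
    by rewrite natrM -!natr1 natrB//; ring.
  by rewrite -[m.+2%:R]natr1 -natr1; field.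
rewrite -mulr_sumr !big_split /= -!mulr_sumr poisson_pmf_sum_id poisson_pmf_sum_sqr.
rewrite /lower_excess /poisson_cdf -[m.+2%:R]natr1 -natr1.
by field.
Qed.

Lemma pmf_lower_excess_le m : p m * lower_excess m <= poisson_cdf m ^+ 2.
Proof.
have := @logconcave_first_moment R _ m.+1 (fun k => p_ge0 (m - k)) (@reversed_logconcave m).
by rewrite subn0 reversed_first_moment reversed_sum.
Qed.

(** Second-moment inequality for the weights read downwards from [m]; the
    left-hand factor is the mean of [D (D + 1)] with [D = (m + 1 - Y)_+]. *)
Lemma lower_second_moment_le m :
  poisson_cdf m * (lam * poisson_cdf m + (m.+2%:R - lam) * lower_excess m) <=
    2 * lower_excess m ^+ 2.
Proof.
have := @logconcave_second_moment R _ m.+1 (fun k => p_ge0 (m - k)) (@reversed_logconcave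
  m).
by rewrite reversed_first_moment reversed_sum reversed_second_moment; lra.
Qed.

Lemma has_poisson_mean_second_moment (s : R) :
  has_poisson_mean (fun k => (k%:R + s) * (k%:R + s + 1) / 2)
   ((lam ^+ 2 + (2 + 2 * s) * lam + s * (s + 1)) / 2).
Proof.
have H := has_poisson_meanZ 2^-1 (has_poisson_meanD (has_poisson_meanD
  (has_poisson_mean_sqr)
  (has_poisson_meanZ (2 + 2 * s) (has_poisson_mean_id))) (@has_poisson_mean_cst (s * (s
    + 1)))).
rewrite mulrC; move: H; rewrite /has_poisson_mean => H.
rewrite (_ : (fun N => _) = (fun N : nat => \sum_(0 <= k < N) p k *
   (2^-1 * (k%:R * (k%:R - 1) + (2 + 2 * s) * k%:R + s * (s + 1)))))//.
by apply/funext => N; apply: eq_bigr => k _; congr (_ * _); field.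
Qed.

(** First-moment inequality for the weights from [m] on.  The sequence starts at
    [m], not at [m + 1], to bring in [p m]; the terms containing [p m] that are
    common to both sides then cancel. *)
Lemma pmf_upper_excess_le m : p m * upper_excess m <= poisson_ccdf m ^+ 2.
Proof.
have H : has_poisson_mean (fun k => k%:R + (1 - m%:R)) (lam + (1 - m%:R)).
  by apply: has_poisson_meanD; [exact: has_poisson_mean_id|exact: has_poisson_mean_cst].
have {}H := has_poisson_mean_tail m H.
have S := has_poisson_mean_tail m (@has_poisson_mean_cst 1).
have cm : \sum_(0 <= k < m) p k = poisson_cdf m - p m
  by rewrite /poisson_cdf big_nat_recr //= addrK.
have cm1 : \sum_(0 <= k < m) p k * k%:R = lam * poisson_cdf m - lam * p m - p m * m%:R.
  by rewrite -poisson_pmf_sum_id [in RHS]big_nat_recr //= addrK.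
have E1 : lam + (1 - m%:R) - \sum_(0 <= k < m) p k * (k%:R + (1 - m%:R)) =
    upper_excess m + 2 * poisson_ccdf m + p m.
  under eq_bigr do rewrite mulrDr.
  by rewrite big_split /= -mulr_suml cm1 cm /upper_excess /poisson_ccdf -natr1; ring.
have E2 : 1 - \sum_(0 <= k < m) p k * 1 = poisson_ccdf m + p m.
  by rewrite -mulr_suml mulr1 cm /poisson_ccdf ; ring.
rewrite {}E1 in H; rewrite {}E2 in S.
suff : p m * (upper_excess m + 2 * poisson_ccdf m + p m) <=
  (poisson_ccdf m + p m) ^+ 2 by lra.
apply: (@ler_limit _ (fun N => p m * \sum_(0 <=
  k < N) p (m + k)%N * ((m + k)%:R + (1 - m%:R)))
   (fun N => (\sum_(0 <= k < N) p (m + k)%N * 1) ^+ 2)).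
- by apply: cvgM => //; exact: cvg_cst.
- by under eq_fun do rewrite expr2; rewrite expr2; apply: cvgM.
move=> N /=.
have := @logconcave_first_moment R _ N (fun k => p_ge0 (m + k)) (@shifted_logconcave m N).
rewrite addn0; congr (_ * _ <= _ ^+ 2); apply: eq_bigr => k _; last by rewrite mulr1.
by rewrite natrD -natr1; ring.
Qed.

(** Second-moment inequality for the weights from [m + 1] on; the left-hand factor
    is the mean of [D (D - 1)] with [D = (Y - m - 1)_+]. *)
Lemma upper_second_moment_le m :
  poisson_ccdf m * (lam * poisson_ccdf m - (m.+2%:R - lam) * upper_excess m) <=
    2 * upper_excess m ^+ 2.
Proof.
have H := has_poisson_mean_tail m.+1 (has_poisson_mean_second_moment (- m%:R)).
have U := upper_excess_cvg m.
have S := poisson_ccdf_cvg m.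
set c := (X in _ --> X) in H.
have {c H}H : (fun N => \sum_(0 <= k < N) (k.+1 * k.+2)%N%:R / 2 * p (m.+1 + k)%N) @ \oo -->
   (lam * poisson_ccdf m - (m.+2%:R - lam) * upper_excess m) / 2 + 2 * upper_excess m
     + poisson_ccdf m.
  have <- : c = (lam * poisson_ccdf m - (m.+2%:R - lam) * upper_excess m) / 2
    + 2 * upper_excess m + poisson_ccdf m.
    rewrite /c (eq_bigr (fun k => 2^-1 * (m%:R * (m%:R - 1) * p k
      + (2 - 2 * m%:R) * (p k * k%:R)
      + p k * (k%:R * (k%:R - 1))))); last by move=> k _; field.
    rewrite -mulr_sumr !big_split /= -!mulr_sumr poisson_pmf_sum_id poisson_pmf_sum_sqr.
    rewrite /upper_excess /poisson_ccdf /poisson_cdf -[m.+2%:R]natr1 -natr1.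
    by field.
  rewrite (_ : (fun N => _) = (fun N : nat => \sum_(0 <= k < N) p (m.+1 + k)%N *
      (((m.+1 + k)%:R + - m%:R) * ((m.+1 + k)%:R + - m%:R + 1) / 2)))//.
  apply/funext => N; apply: eq_bigr => k _.
  by rewrite natrM natrD -![_.+1%:R]natr1 mulrC; field.
suff : poisson_ccdf m * ((lam * poisson_ccdf m - (m.+2%:R - lam) * upper_excess m) / 2
  + 2 * upper_excess m + poisson_ccdf m)
  <= (upper_excess m + poisson_ccdf m) ^+ 2 by lra.
apply: (@ler_limit _ (fun N => (\sum_(0 <= k < N) p (m.+1 + k)%N) *
     (\sum_(0 <= k < N) (k.+1 * k.+2)%N%:R / 2 * p (m.+1 + k)%N))
   (fun N => (\sum_(0 <= k < N) k%:R * p (m.+1 + k)%N + \sum_(0 <=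
     k < N) p (m.+1 + k)%N) ^+ 2)).
- by apply: cvgM.
- by under eq_fun do rewrite expr2; rewrite expr2; apply: cvgM; apply: cvgD.
move=> N /=.
have := @logconcave_second_moment R _ N (fun k => p_ge0 (m.+1
  + k)) (@shifted_logconcave m.+1 N).
congr (_ <= _ ^+ 2); rewrite -big_split /=; apply: eq_bigr => k _.
by rewrite -natr1; ring.
Qed.


(** With [F], [T] the two probabilities and [a], [b] the two excesses, multiplying
    the upper second-moment inequality by [a F] and the lower one by [b T] makes
    the terms in [m + 2 - lam] cancel in the sum, which leaves
    [lam T F <= 2 a b].  The arithmetic-geometric inequality
    [4 (T a) (F b) <= (T a + F b)^2 = (lam p)^2] then removes [a b]. *)
Lemma cdf_ccdf_sqr_le m : 2 * (poisson_cdf m * poisson_ccdf m) ^+ 2 <= lam * p m ^+ 2.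
Proof.
have S := excess_balance m.
have h1 := upper_second_moment_le m.
have h2 := lower_second_moment_le m.
have F0 := poisson_cdf_ge0 m.
have T0 := poisson_ccdf_ge0 m.
have b0 := upper_excess_ge0 m.
have a0 : 0 <= lower_excess m := le_trans F0 (poisson_cdf_le_lower_excess m).
have P0 := poisson_pmf_gt0 m.
move: (poisson_cdf m) (poisson_ccdf m) (lower_excess m) (upper_excess m) (m.+2%:R - lam)
  (p m) F0 T0 a0 b0 P0 S h1 h2.
move=> F T a b e P F0 T0 a0 b0 P0 S h1 h2.
have k1 : (lam * T ^+ 2 - e * b * T) * (a * F) <= 2 * b ^+ 2 * (a * F).
  by rewrite ler_wpM2r ?mulr_ge0//; move: h1; lra.
have k2 : (lam * F ^+ 2 + e * a * F) * (b * T) <= 2 * a ^+ 2 * (b * T).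
  by rewrite ler_wpM2r ?mulr_ge0//; move: h2; lra.
have lP : 0 < lam * P by rewrite mulr_gt0.
have h3 : lam * (T * F) <= 2 * (a * b).
  rewrite -(ler_pM2r lP) -S.
  have -> : lam * (T * F) * (T * a + F * b) =
    (lam * T ^+ 2 - e * b * T) * (a * F) + (lam * F ^+ 2 + e * a * F) * (b * T) by ring.
  by apply: (le_trans (lerD k1 k2)); rewrite le_eqVlt; apply/orP; left; apply/eqP; ring.
have TF0 : 0 <= T * F by rewrite mulr_ge0.
have h4 : lam * (T * F) * (T * F) <= 2 * (a * b) * (T * F) by rewrite ler_wpM2r.
have h5 : 4 * (a * b * (T * F)) <= (lam * P) ^+ 2.
  by rewrite -S -subr_ge0 (_ : _ - _ = (T * a - F * b) ^+ 2) ?sqr_ge0//; ring.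
by rewrite -(ler_pM2l lam_gt0); move: h4 h5; lra.
Qed.

(** Same combination as for [cdf_ccdf_sqr_le], with the first-moment inequalities
    [p b <= T^2] and [p a <= F^2]: it gives [a b <= lam T F], an estimate in the
    opposite direction, and now the arithmetic-geometric inequality removes
    [T F]. *)
Lemma lower_upper_sqr_le m : (2 * (lower_excess m * upper_excess m)) ^+ 2 <=
  lam ^+ 3 * p m ^+ 2.
Proof.
have S := excess_balance m.
have h1 := pmf_upper_excess_le m.
have h2 := pmf_lower_excess_le m.
have F0 := poisson_cdf_ge0 m.
have T0 := poisson_ccdf_ge0 m.
have b0 := upper_excess_ge0 m.
have a0 : 0 <= lower_excess m := le_trans F0 (poisson_cdf_le_lower_excess m).
have P0 := poisson_pmf_gt0 m.
have FT : poisson_cdf m + poisson_ccdf m = 1 by rewrite /poisson_ccdf addrC subrK.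
move: (poisson_cdf m) (poisson_ccdf m) (lower_excess m) (upper_excess m) (p m) F0 T0 a0
  b0 P0 FT S h1 h2.
move=> F T a b P F0 T0 a0 b0 P0 FT S h1 h2.
have lP : 0 < lam * P by rewrite mulr_gt0.
have k1 : lam * (P * b) * (a * F) <= lam * T ^+ 2 * (a * F).
  by rewrite ler_wpM2r ?mulr_ge0// ler_wpM2l// ltW.
have k2 : lam * (P * a) * (b * T) <= lam * F ^+ 2 * (b * T).
  by rewrite ler_wpM2r ?mulr_ge0// ler_wpM2l// ltW.
have h3 : a * b <= lam * (T * F).
  (* The two products add up to [lam P a b (F + T)]. *)
  rewrite -(ler_pM2l lP).
  have -> : lam * P * (a * b) = lam * (P * b) * (a * F) + lam * (P * a) * (b * T).
    by rewrite -[LHS]mulr1 -FT; ring.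
  apply: (le_trans (lerD k1 k2)); rewrite -S.
  by rewrite le_eqVlt; apply/orP; left; apply/eqP; ring.
have ab0 : 0 <= a * b by rewrite mulr_ge0.
have h4 : a * b * (a * b) <= lam * (T * F) * (a * b) by rewrite ler_wpM2r.
have h5 : 4 * (a * b * (T * F)) <= (lam * P) ^+ 2.
  by rewrite -S -subr_ge0 (_ : _ - _ = (T * a - F * b) ^+ 2) ?sqr_ge0//; ring.
have h6 : lam * (4 * (a * b * (T * F))) <= lam * (lam * P) ^+ 2.
  by rewrite ler_wpM2l// ltW.
by move: h4 h6; lra.
Qed.

Lemma cdf_ccdf_le_pmf m : poisson_cdf m * poisson_ccdf m <= lam * p m.
Proof.
rewrite -excess_balance mulrC -[leLHS]addr0 lerD ?mulr_ge0 ?poisson_cdf_ge0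
  ?upper_excess_ge0//.
by rewrite ler_wpM2l ?poisson_ccdf_ge0// poisson_cdf_le_lower_excess.
Qed.

Lemma cdf_ccdf_le_sqrt m : poisson_cdf m * poisson_ccdf m <= Num.sqrt lam * p m.
Proof.
have x0 : 0 <= poisson_cdf m * poisson_ccdf m
  by rewrite mulr_ge0 ?poisson_cdf_ge0 ?poisson_ccdf_ge0.
rewrite -(@ler_pXn2r _ 2) ?nnegrE ?mulr_ge0 ?sqrtr_ge0 ?poisson_cdf_ge0 ?poisson_ccdf_ge0//.
rewrite [leRHS]exprMn sqr_sqrtr ?(ltW lam_gt0)//; apply: (le_trans _ (cdf_ccdf_sqr_le m)).
by rewrite ler_peMl ?sqr_ge0// ler1n.
Qed.

Lemma lower_upper_le_sqrt m :
  2 * (lower_excess m * upper_excess m) <= lam * Num.sqrt lam * p m.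
Proof.
have a0 : 0 <= lower_excess m := le_trans (poisson_cdf_ge0 m)
  (poisson_cdf_le_lower_excess m).
have l0 := ltW lam_gt0.
rewrite -(@ler_pXn2r _ 2) ?nnegrE ?mulr_ge0 ?sqrtr_ge0 ?upper_excess_ge0//.
apply: (le_trans (lower_upper_sqr_le m)).
by rewrite [leRHS]exprMn [(lam * _) ^+ 2]exprMn sqr_sqrtr// -exprSr.
Qed.

Lemma poisson_pmf_le k : lam <= 1 -> p k <= expR (- lam).
Proof.
move=> l1; rewrite poisson_pmfE ler_piMr ?expR_ge0//.
rewrite /exp_coeff /= ler_pdivrMr ?ltr0n ?fact_gt0// mul1r.
apply: (@le_trans _ _ 1); first by rewrite exprn_ile1// ltW.
by rewrite ler1n fact_gt0.
Qed.

(** Log-concavity against [p 1] gives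
    [k p_(m+1+k) <= exp lam * p_(k-1) p_(m+2)], and the weights sum to [1]. *)
Lemma upper_excess_le m : expR (- lam) * upper_excess m <= p m.+2.
Proof.
have H : (fun N => expR (- lam) * \sum_(0 <= k < N.+1) k%:R * p (m.+1 + k)%N) @ \oo -->
    expR (- lam) * upper_excess m.
  apply: cvgM; first exact: cvg_cst.
  by rewrite (cvg_shiftS (fun N => \sum_(0 <= k < N) k%:R * p (m.+1 + k)%N));
    exact: upper_excess_cvg.
have G : (fun N => p m.+2 * \sum_(0 <= k < N) p k) @ \oo --> p m.+2 * 1.
  by apply: cvgM; [exact: cvg_cst|exact: poisson_pmf_sum_cvg].
rewrite -[leRHS]mulr1; apply: (ler_limit H G) => N.
rewrite big_nat_recl //= mul0r add0r !mulr_sumr; apply: ler_sum => k _.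
have H1 : p 1 * p (m.+2 + k)%N <= p k.+1 * p m.+2 by exact: poisson_pmf_logconcave.
have := ler_wpM2l (ler0n R k.+1) H1.
have -> : p 1 = lam * expR (- lam) by rewrite poisson_pmfE /exp_coeff /= expr1 divr1 mulrC.
have -> : k.+1%:R * (p k.+1 * p m.+2) = lam * (p k * p m.+2)
  by rewrite mulrA poisson_pmfS mulrA.
have -> : k.+1%:R * (lam * expR (- lam) * p (m.+2 + k)%N) =
  lam * (expR (- lam) * (k.+1%:R * p (m.+2 + k)%N)) by ring.
by rewrite ler_pM2l// [p k * _]mulrC addSnnS.
Qed.

(** Since [lam^2 p_m = (m + 1) (m + 2) p_(m+2)], it is enough to pair the bound of
    [upper_excess_le] with a lower excess of at most
    [exp (- lam) (1 + ... + (m + 1))]. *)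
Lemma lower_upper_le_small m : lam <= 1 ->
  2 * (lower_excess m * upper_excess m) <= lam ^+ 2 * p m.
Proof.
move=> l1.
have -> : lam ^+ 2 * p m = m.+1%:R * m.+2%:R * p m.+2.
  by rewrite -mulrA poisson_pmfS mulrCA poisson_pmfS mulrA.
have aE : 2 * lower_excess m <= m.+1%:R * m.+2%:R * expR (- lam).
  have -> : (m.+1%:R * m.+2%:R : R) = 2 * \sum_(0 <= k < m.+1) (m.+1 - k)%:R.
    rewrite big_nat_rev /= (eq_big_nat _ _ (F2 := fun k => k.+1%:R)); last first.
      by move=> k /andP[_ km]; congr (_%:R); lia.
    elim: m => [|m IH]; first by rewrite big_nat1; ring.
    by rewrite big_nat_recr //= [RHS]mulrDr -IH -[m.+3%:R]natr1 -[m.+2%:R]natr1; ring.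
  rewrite lower_excessE -mulrA ler_pM2l// mulr_suml; apply: ler_sum => k _.
  by apply: ler_wpM2l => //; exact: poisson_pmf_le.
rewrite mulrA; apply: (le_trans (ler_wpM2r (upper_excess_ge0 m) aE)).
by rewrite -[leLHS]mulrA ler_wpM2l ?mulr_ge0// upper_excess_le.
Qed.

(** * The Stein equation and its solutions *)

(** The recursion is the Stein equation solved for the next value.  That equation
    leaves the value at [0] free; [0] agrees with the extension by zero to the
    negative integers used for [X + Z + 1]. *)
Fixpoint stein (g : nat -> R) (c : R) (k : nat) : R :=
  if k is j.+1 then (j%:R * stein g c j + (g j - c)) / lam else 0.

Lemma stein_eq g c k : lam * stein g c k.+1 = k%:R * stein g c k + (g k - c).
Proof. by rewrite /= mulrCA mulfV ?mulr1// gt_eqF. Qed.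

(** Multiplied by [p k], the Stein equation telescopes because
    [lam p_k = (k + 1) p_(k+1)]. *)
Lemma stein_sum g c m :
  lam * p m * stein g c m.+1 = \sum_(0 <= k < m.+1) p k * (g k - c).
Proof.
elim: m => [|m IH].
  by rewrite big_nat1 mulrAC stein_eq mul0r add0r mulrC.
rewrite big_nat_recr // -IH -(poisson_pmfS m).
have := stein_eq g c m.+1; move: (stein g c m.+2) (stein g c m.+1) => u v E.
transitivity (p m.+1 * (lam * u)); first by ring.
by rewrite E /=; ring.
Qed.

Section SteinBounds.
Variables (g : nat -> R) (c : R).
Hypothesis gc : has_poisson_mean g c.
Local Notation f := (stein g c).

(** Contributions of [0..m] and of the integers beyond [m] to the mean of
    [g - s]. *)
Definition part_below s m := \sum_(0 <= k < m.+1) p k * (g k - s).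
Definition part_above s m := (c - s) - part_below s m.

Lemma above_cvg s m :
  (fun N => \sum_(0 <= k < N) p (m.+1 + k)%N * (g (m.+1 + k)%N - s)) @ \oo -->
    part_above s m.
Proof.
by apply: (@has_poisson_mean_tail (fun k => g k - s)); apply: has_poisson_meanD => //;
  exact: has_poisson_mean_cst.
Qed.

(** The shift [s] is free, since the Stein solution sees only [g - c]: for
    Lipschitz functions [s = g m.+1] is convenient, for indicators [s = 0]. *)
Lemma stein_below_above s m :
  lam * p m * f m.+1 = poisson_ccdf m * part_below s m - poisson_cdf m * part_above s m.
Proof.
rewrite stein_sum.
have -> : \sum_(0 <= k < m.+1) p k * (g k - c) = part_below s m - poisson_cdf m * (c - s).
  by rewrite /poisson_cdf mulr_suml -sumrB; apply: eq_bigr => k _; ring.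
by rewrite /part_above /poisson_ccdf; ring.
Qed.

(** For [s = g m.+1] the Stein equation at [m + 1] has no term [g m.+1 - s], and
    the coefficients of the two parts reduce to the two excesses. *)
Lemma stein_diff m :
  lam ^+ 2 * p m * (f m.+2 - f m.+1) =
  - (part_below (g m.+1) m * upper_excess m + part_above (g m.+1) m * lower_excess m).
Proof.
set s := g m.+1.
have E1 := stein_below_above s m; have E2 := stein_eq g c m.+1.
have {}E2 : lam * f m.+2 = m.+1%:R * f m.+1 - (part_below s m + part_above s m).
  by rewrite E2 /part_above -/s; ring.
have -> : lam ^+ 2 * p m * (f m.+2 - f m.+1) =
  (m.+1%:R - lam) * (lam * p m * f m.+1) - lam * p m * (part_below s m + part_above s m).
  transitivity (lam * p m * (lam * f m.+2) - lam ^+ 2 * p m * f m.+1); first by ring.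
  by rewrite E2; ring.
by rewrite E1 /upper_excess /lower_excess /poisson_ccdf; ring.
Qed.

End SteinBounds.

Section LipschitzTest.
Variables (g : nat -> R) (c : R).
Hypotheses (gc : has_poisson_mean g c) (gLip : Lip1 g).
Local Notation f := (stein g c).

Lemma below_lip m : `|part_below g (g m.+1) m| <= lower_excess m.
Proof.
apply: (le_trans (ler_norm_sum _ _ _)); rewrite lower_excessE.
apply: ler_sum_nat => k /andP[_ km].
rewrite normrM ger0_norm// mulrC ler_wpM2r//.
apply: (le_trans (gLip _ _)).
by rewrite distrC -natrB ?ger0_norm ?ler0n// ltnW.
Qed.

Lemma above_lip m : `|part_above g c (g m.+1) m| <= upper_excess m.
Proof.
have H : (fun N => `|\sum_(0 <= k < N) p (m.+1 + k)%N * (g (m.+1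
  + k)%N - g m.+1)|) @ \oo -->
    `|part_above g c (g m.+1) m| by apply: cvg_norm; exact: above_cvg.
apply: (ler_limit H (upper_excess_cvg m)) => N.
apply: (le_trans (ler_norm_sum _ _ _)).
apply: ler_sum_nat => k _.
rewrite normrM ger0_norm// mulrC ler_wpM2r//.
apply: (le_trans (gLip _ _)).
by rewrite natrD addrAC subrr add0r ger0_norm.
Qed.

(** Each part is at most the corresponding excess, so the numerator is bounded by
    the left-hand side of [excess_balance]. *)
Lemma stein_lip_bound m : `|f m.+1| <= 1.
Proof.
have lp : 0 < lam * p m by rewrite mulr_gt0 ?poisson_pmf_gt0.
rewrite -(ler_pM2l lp) -{1}(gtr0_norm lp) -normrM (stein_below_above _ _ (g m.+1)).
rewrite mulr1 -excess_balance; apply: (le_trans (ler_normB _ _)).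
rewrite !normrM (ger0_norm (poisson_cdf_ge0 m)) (ger0_norm (poisson_ccdf_ge0 m)).
by apply: lerD; apply: ler_wpM2l;
  rewrite ?poisson_cdf_ge0 ?poisson_ccdf_ge0 ?below_lip ?above_lip.
Qed.

Lemma stein_lip_diff m :
  lam ^+ 2 * p m * `|f m.+2 - f m.+1| <= 2 * (lower_excess m * upper_excess m).
Proof.
have lp : 0 <= lam ^+ 2 * p m by rewrite mulr_ge0// exprn_ge0// ltW.
rewrite -{1}(ger0_norm lp) -normrM stein_diff normrN.
apply: (le_trans (ler_normD _ _)); rewrite !normrM.
have -> : 2 * (lower_excess m * upper_excess m) =
  lower_excess m * upper_excess m + lower_excess m * upper_excess m by ring.
rewrite (ger0_norm (upper_excess_ge0 m)) (ger0_norm (le_trans (poisson_cdf_ge0 m)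
  (poisson_cdf_le_lower_excess m))).
rewrite lerD//; first by rewrite ler_wpM2r ?upper_excess_ge0// below_lip.
rewrite mulrC ler_wpM2l//; last exact: above_lip.
exact: le_trans (poisson_cdf_ge0 m) (poisson_cdf_le_lower_excess m).
Qed.

Lemma stein_lip_diff_sqrt m : Num.sqrt lam * `|f m.+2 - f m.+1| <= 1.
Proof.
have sl : 0 < Num.sqrt lam by rewrite sqrtr_gt0.
have h : 0 < lam * Num.sqrt lam * p m by rewrite !mulr_gt0// poisson_pmf_gt0.
rewrite -(ler_pM2l h) mulr1; apply: (le_trans _ (lower_upper_le_sqrt m)).
apply: (le_trans _ (stein_lip_diff m)).
rewrite [leLHS](_ : _ = lam * Num.sqrt lam ^+ 2 * p m * `|f m.+2 - f m.+1|); last by ring.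
by rewrite sqr_sqrtr ?(ltW lam_gt0)// -expr2.
Qed.

(** For [lam >= 1] this is weaker than the bound by [1 / sqrt lam]. *)
Lemma stein_lip_diff_one m : `|f m.+2 - f m.+1| <= 1.
Proof.
have [l1|/ltW l1] := leP lam 1.
  have h : 0 < lam ^+ 2 * p m by rewrite mulr_gt0 ?exprn_gt0// poisson_pmf_gt0.
  rewrite -(ler_pM2l h) mulr1; apply: (le_trans _ (lower_upper_le_small m l1)).
  exact: stein_lip_diff.
apply: (le_trans _ (stein_lip_diff_sqrt m)); rewrite ler_peMl//.
by rewrite -{1}[1]sqrtr1 ler_wsqrtr.
Qed.

Lemma stein_lip_step k : `|f k.+1 - f k| <= 1.
Proof.
case: k => [|k]; first by rewrite /= subr0 -/(f 1); exact: stein_lip_bound.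
exact: stein_lip_diff_one.
Qed.

(** The constant enters only through [1 <= 11437 / 10000]: the steps are at most
    [1 / sqrt lam]. *)
Lemma stein_lip_step_pos k : (0 < k)%N ->
  lam * `|f k.+1 - f k| <= Num.min (11437 / 10000 * Num.sqrt lam) lam.
Proof.
case: k => // k _; rewrite le_min; apply/andP; split; last first.
  by rewrite ler_piMr ?(ltW lam_gt0)// stein_lip_diff_one.
have s0 := sqrtr_ge0 lam.
apply: (@le_trans _ _ (Num.sqrt lam)); last by rewrite ler_peMl//; lra.
rewrite -{1}(@sqr_sqrtr _ lam) ?(ltW lam_gt0)// expr2 -mulrA ler_piMr//.
exact: stein_lip_diff_sqrt.
Qed.

End LipschitzTest.

Lemma steinN g c k : stein (fun j => 1 - g j) (1 - c) k = - stein g c k.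
Proof.
elim: k => [|k IH]; first by rewrite /= oppr0.
by rewrite /= IH; ring.
Qed.

Section IndicatorTest.
Implicit Types (b : nat -> bool) (c : R).

Lemma below_ind b m : 0 <= part_below (fun k => (b k)%:R) 0 m <= poisson_cdf m.
Proof.
rewrite /part_below sumr_ge0 => [|k _]; last by rewrite subr0 mulr_ge0.
by apply: ler_sum => k _; rewrite subr0 ler_piMr// lern1 leq_b1.
Qed.

Lemma above_ind b c m : has_poisson_mean (fun k => (b k)%:R) c ->
  0 <= part_above (fun k => (b k)%:R) c 0 m <= poisson_ccdf m.
Proof.
move=> bc; have H := above_cvg bc 0 m; apply/andP; split.
  apply: (ler_limit (cvg_cst 0) H) => N; apply: sumr_ge0 => k _.
  by rewrite subr0 mulr_ge0.
apply: (ler_limit H (poisson_ccdf_cvg m)) => N; apply: ler_sum => k _.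
by rewrite subr0 ler_piMr// lern1 leq_b1.
Qed.

Lemma stein_ind_bound b c m : has_poisson_mean (fun k => (b k)%:R) c ->
  lam * p m * `|stein (fun k => (b k)%:R) c m.+1| <= poisson_cdf m * poisson_ccdf m.
Proof.
move=> bc; have lp : 0 <= lam * p m by rewrite mulr_ge0// ltW.
rewrite -{1}(ger0_norm lp) -normrM (stein_below_above _ _ 0).
have /andP[A0 A1] := below_ind b m; have /andP[B0 B1] := @above_ind b c m bc.
have F0 := poisson_cdf_ge0 m; have T0 := poisson_ccdf_ge0 m.
have := ler_wpM2l F0 B1; have := ler_wpM2l T0 A1.
have := mulr_ge0 T0 A0; have := mulr_ge0 F0 B0.
by rewrite ler_norml; lra.
Qed.

Lemma stein_ind_le1 b c m : has_poisson_mean (fun k => (b k)%:R) c ->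
  `|stein (fun k => (b k)%:R) c m.+1| <= 1.
Proof.
move=> bc; have lp : 0 < lam * p m by rewrite mulr_gt0// poisson_pmf_gt0.
by rewrite -(ler_pM2l lp) mulr1 (le_trans (@stein_ind_bound b c m bc))// cdf_ccdf_le_pmf.
Qed.

Lemma stein_ind_le b c m : has_poisson_mean (fun k => (b k)%:R) c ->
  `|stein (fun k => (b k)%:R) c m.+1| <= Num.min 1 (Num.sqrt lam)^-1.
Proof.
move=> bc; rewrite le_min stein_ind_le1//=.
have lp : 0 < lam * p m by rewrite mulr_gt0// poisson_pmf_gt0.
have sl : 0 < Num.sqrt lam by rewrite sqrtr_gt0.
rewrite -(ler_pM2l lp) (le_trans (@stein_ind_bound b c m bc))//.
rewrite [leRHS](_ : _ = Num.sqrt lam * p m) ?cdf_ccdf_le_sqrt//.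
have E := sqr_sqrtr (ltW lam_gt0).
rewrite -{1}E; field; by rewrite gt_eqF.
Qed.

(** Passing to the complementary event changes the sign of the solution, so one may
    assume that [m + 1] is not in the event.  Then both parts are nonnegative, and
    the upper one is at most the tail beyond [m + 1]; by [excess_balance] the
    numerator is at most [lam p_m - p_(m+1) a], with [a] the lower excess, and
    [a >= m + 1 - lam]. *)
Lemma stein_ind_step b c k : has_poisson_mean (fun k => (b k)%:R) c ->
  lam * `|stein (fun k => (b k)%:R) c k.+1 - stein (fun k => (b k)%:R) c k|
  <= Num.min 1 lam.
Proof.
move=> bc; case: k => [|m].
  rewrite [stein _ _ 0]/= subr0.
  have F0E : poisson_cdf 0 = p 0 by rewrite /poisson_cdf big_nat1.
  have P0 := poisson_pmf_gt0 0.
  have := @stein_ind_bound b c 0 bc; rewrite F0E mulrAC mulrC ler_pM2l// => h.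
  have := cdf_ccdf_le_pmf 0; rewrite F0E mulrC ler_pM2r// => h'.
  rewrite le_min (le_trans h)//= ?(le_trans h h')//.
  by rewrite /poisson_ccdf lerBlDr lerDl poisson_cdf_ge0.
wlog : b c bc / ~~ b m.+1.
  move=> H; have [bm|] := boolP (b m.+1); last exact: H.
  have bE : (fun k => 1 - (b k)%:R) = (fun k => (~~ b k)%:R) :> (nat -> R).
    by apply/funext => k; case: (b k); rewrite ?subrr ?subr0.
  have Hc : has_poisson_mean (fun k => (~~ b k)%:R) (1 - c).
    rewrite -bE -mulN1r (_ : (fun k => _) = (fun k => 1 + -1 * (b k)%:R)).
      by apply: has_poisson_meanD; [exact: has_poisson_mean_cst|exact: has_poisson_meanZ].
    by apply/funext => k; rewrite mulN1r.
  have := H _ _ Hc; rewrite -bE !steinN -opprD normrN; apply.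
  by rewrite negbK.
move=> bm; set g := (fun k => _); have gm : g m.+1 = 0 by rewrite /g (negbTE bm).
have := stein_diff g c m; rewrite gm => E.
have /andP[A0 A1] : 0 <= part_below g 0 m <= poisson_cdf m := below_ind b m.
have B01 : part_above g c 0 m = part_above g c 0 m.+1.
  rewrite /part_above; congr (_ - _).
  by rewrite [RHS]/part_below big_nat_recr //= gm subrr mulr0 addr0.
have /andP[B0 B1] : 0 <= part_above g c 0 m <= poisson_ccdf m.+1 by rewrite B01;
  exact: (@above_ind b c m.+1 bc).
have F0 := poisson_cdf_ge0 m.
have T0 := poisson_ccdf_ge0 m.
have b0 := upper_excess_ge0 m.
have aF := poisson_cdf_le_lower_excess m; have a0 := le_trans F0 aF.
have P0 := poisson_pmf_gt0 m; have P1 := poisson_pmf_gt0 m.+1.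
have S := excess_balance m.
have TS : poisson_ccdf m.+1 = poisson_ccdf m - p m.+1
  by rewrite /poisson_ccdf poisson_cdfS; ring.
have lp : 0 < lam * p m by rewrite mulr_gt0.
have {}E : lam * p m * (lam * `|stein g c m.+2 - stein g c m.+1|) =
    part_below g 0 m * upper_excess m + part_above g c 0 m * lower_excess m.
  rewrite mulrA [X in X * _](_ : _ = lam ^+ 2 * p m); last by ring.
  have l2p : 0 <= lam ^+ 2 * p m by rewrite mulr_ge0// exprn_ge0// ltW.
  by rewrite -{1}(ger0_norm l2p) -normrM E normrN ger0_norm// addr_ge0// mulr_ge0.
have E2 : lam * p m * (lam * `|stein g c m.+2 - stein g c m.+1|) <=
    lam * p m - p m.+1 * lower_excess m.
  rewrite E -S addrAC -mulrBl -TS.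
  by rewrite addrC; apply: lerD; apply: ler_wpM2r.
rewrite le_min; apply/andP; split; rewrite -(ler_pM2l lp) (le_trans E2)//.
  by rewrite mulr1 gerBl mulr_ge0// ltW.
have aD : m.+1%:R - lam <= lower_excess m.
  have -> : m.+1%:R - lam = lower_excess m - upper_excess m
    by rewrite /lower_excess /upper_excess /poisson_ccdf; ring.
  by rewrite gerBl.
have PS := poisson_pmfS m.
apply: (@le_trans _ _ (lam * p m.+1)).
  rewrite lerBlDr -lerBlDl -PS -mulrBl mulrC.
  by apply: ler_wpM2l => //; exact: ltW.
rewrite [leRHS]mulrC; apply: ler_wpM2l; first exact: ltW.
by rewrite -PS ler_peMl ?(ltW P1)// ler1n.
Qed.

End IndicatorTest.

Section CdfTest.
Variable v : nat.
Local Notation b := (fun k : nat => (k <= v)%N%:R : R).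
Local Notation f := (stein b (poisson_cdf v)).

Lemma sum_cdf_test n : (v <= n)%N ->
  \sum_(0 <= k < n.+1) p k * (k <= v)%N%:R = poisson_cdf v.
Proof.
move=> vn; rewrite (big_cat_nat (n := v.+1)) //= [X in _ + X]big1_seq ?addr0; last first.
  move=> k /=; rewrite mem_index_iota => /andP[vk _].
  by rewrite leqNgt vk mulr0.
by apply: eq_big_nat => k /andP[_]; rewrite ltnS => ->; rewrite mulr1.
Qed.

Lemma has_poisson_mean_cdf_test : has_poisson_mean b (poisson_cdf v).
Proof.
rewrite /has_poisson_mean -(cvg_shiftn v.+1) /=.
under eq_fun do rewrite addnS sum_cdf_test ?leq_addl//.
exact: cvg_cst.
Qed.

(** Beyond [v] the test function of the event [Y <= v] vanishes, and the solution
    is an explicit multiple of the ratio of tail to weight.  The case [v = 0] is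
    the event [Y = 0]. *)
Lemma stein_cdf n : (v <= n)%N -> lam * p n * f n.+1 = poisson_cdf v * poisson_ccdf n.
Proof.
move=> vn; rewrite stein_sum.
under eq_bigr do rewrite mulrBr.
by rewrite sumrB -mulr_suml sum_cdf_test// -/(poisson_cdf n) /poisson_ccdf; ring.
Qed.

Lemma stein_cdfE n : (v <= n)%N -> lam * f n.+1 = poisson_cdf v * (poisson_ccdf n / p n).
Proof.
move=> vn; have P0 : p n != 0 by rewrite gt_eqF ?poisson_pmf_gt0.
by apply: (mulIf P0); rewrite mulrAC stein_cdf// -!mulrA mulVf ?mulr1.
Qed.

Lemma stein_cdf_ge0 n : (v <= n)%N -> 0 <= f n.+1.
Proof.
move=> vn; rewrite -(pmulr_rge0 _ lam_gt0) stein_cdfE//.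
by rewrite mulr_ge0 ?divr_ge0 ?poisson_cdf_ge0 ?poisson_ccdf_ge0.
Qed.

Lemma stein_cdf_noninc j k : (v <= j)%N -> (j <= k)%N -> f k.+1 <= f j.+1.
Proof.
move=> vj jk; rewrite -(ler_pM2l lam_gt0) !stein_cdfE ?(leq_trans vj)//.
apply: ler_wpM2l; first exact: poisson_cdf_ge0.
rewrite ler_pdivrMr ?poisson_pmf_gt0// mulrAC ler_pdivlMr ?poisson_pmf_gt0//.
by rewrite mulrC poisson_hazard_nondec.
Qed.

Lemma stein_cdf_dist k x y : (v <= k)%N -> (k <= x)%N -> (k <= y)%N ->
  `|f x.+1 - f y.+1| <= f k.+1.
Proof.
move=> vk kx ky.
have := @stein_cdf_ge0 x (leq_trans vk kx); have := @stein_cdf_ge0 y (leq_trans vk ky).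
have := @stein_cdf_noninc k x vk kx; have := @stein_cdf_noninc k y vk ky.
move: (f x.+1) (f y.+1) (f k.+1) => r s t h1 h2 h3 h4.
by rewrite ler_norml; lra.
Qed.

End CdfTest.

Lemma poisson_ccdf_le1 m : poisson_ccdf m <= 1.
Proof. by rewrite /poisson_ccdf gerBl poisson_cdf_ge0. Qed.

Lemma poisson_cdf_le1 m : poisson_cdf m <= 1.
Proof. by rewrite -subr_ge0 poisson_ccdf_ge0. Qed.

Lemma poisson_cdf0 : poisson_cdf 0 = p 0.
Proof. by rewrite /poisson_cdf big_nat1. Qed.

Local Notation f0 := (stein (fun k : nat => (k <= 0)%N%:R) (poisson_cdf 0)).

(** The left-hand side is [p 0] times the ratio of tail to weight at [k].  Bounding
    the tail by [1] gives the second branch; log-concavity, in the form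
    [p_0 p_(k+1+l) <= p_l p_(k+1)], gives the first. *)
Lemma stein_zero_le k :
  lam * f0 k.+1 <= Num.min (lam / k.+1%:R) (k`!%:R / lam ^+ k).
Proof.
have P0 := poisson_pmf_gt0 k.
rewrite stein_cdfE// poisson_cdf0 le_min mulrA; apply/andP; split.
  rewrite ler_pdivrMr// mulrAC -poisson_pmfS mulrAC mulfV ?pnatr_eq0// mul1r.
  have H : (fun N => p 0 * \sum_(0 <= l < N) p (k.+1 + l)%N) @ \oo --> p 0 * poisson_ccdf k.
    by apply: cvgM; [exact: cvg_cst|exact: poisson_ccdf_cvg].
  have G : (fun N => \sum_(0 <= l < N) p l * p k.+1) @ \oo --> 1 * p k.+1.
    under eq_fun do rewrite -mulr_suml.
    by apply: cvgM; [exact: poisson_pmf_sum_cvg|exact: cvg_cst].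
  rewrite -[leRHS]mul1r; apply: (ler_limit H G) => N.
  rewrite mulr_sumr; apply: ler_sum => l _.
  by rewrite -{2}[l]add0n poisson_pmf_logconcave.
have -> : k`!%:R / lam ^+ k = p 0 / p k.
  rewrite !poisson_pmfE /exp_coeff /= fact0 expr0 divr1 mulr1.
  have e0 : expR (- lam) != 0 by rewrite gt_eqF ?expR_gt0.
  have l0 : lam ^+ k != 0 by rewrite expf_neq0 ?gt_eqF.
  have k0 : k`!%:R != 0 :> R by rewrite pnatr_eq0 -lt0n fact_gt0.
  by field; rewrite e0 l0 k0.
by rewrite mulrAC; apply: ler_piMr; rewrite ?poisson_ccdf_le1// divr_ge0.
Qed.

Lemma stein_zero_first : f0 1 <= Num.min 1 lam^-1.
Proof.
have := @stein_ind_le1 _ _ 0 (@has_poisson_mean_cdf_test 0).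
rewrite ger0_norm ?stein_cdf_ge0// => h; rewrite le_min h /=.
rewrite -(ler_pM2l lam_gt0) stein_cdfE// poisson_cdf0 mulfV ?gt_eqF// mulrCA mulfV
  ?gt_eqF ?poisson_pmf_gt0//.
by rewrite mulr1 poisson_ccdf_le1.
Qed.

Lemma stein_zero_rest m : f0 m.+2 <= Num.min 1 (lam ^+ 2)^-1.
Proof.
have := @stein_ind_le1 _ _ m.+1 (@has_poisson_mean_cdf_test 0).
rewrite ger0_norm ?stein_cdf_ge0// => h; rewrite le_min h /=.
apply: (@le_trans _ _ (f0 2)); first exact: stein_cdf_noninc.
have E := @stein_cdf 0 1 isT; have PS := poisson_pmfS 0.
rewrite [X in _ = X * _]poisson_cdf0 -[p 1]mul1r PS in E.
have P0 : p 0 != 0 by rewrite gt_eqF ?poisson_pmf_gt0.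
have {}E : f0 2 * lam ^+ 2 = poisson_ccdf 1 by apply: (mulfI P0); rewrite -E;
  move: (f0 2) => u; ring.
by rewrite -[leRHS]mul1r ler_pdivlMr ?exprn_gt0// E poisson_ccdf_le1.
Qed.

Lemma poisson_pmf_nondec j k : k%:R <= lam -> (j <= k)%N -> p j <= p k.
Proof.
move=> kl jk; elim: k kl jk => [|k IH] kl; first by rewrite leqn0 => /eqP ->.
rewrite leq_eqVlt => /orP[/eqP -> //|]; rewrite ltnS => jk.
apply: (@le_trans _ _ (p k)).
  by apply: IH => //; apply: le_trans kl; rewrite ler_nat.
rewrite -(ler_pM2l lam_gt0) -poisson_pmfS ler_wpM2r//.
Qed.

(** If [lam <= v + 1], the tail beyond [v + 1] is at most [lam p_(v+1)] because the
    upper excess is nonnegative.  If [lam >= v + 1], the weights increase up to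
    [v], so that the first [v + 1] of them sum to at most [(v + 1) p_v]. *)
Lemma stein_cdf_le v :
  lam * stein (fun k : nat => (k <= v)%N%:R) (poisson_cdf v) v.+2 <= v.+1%:R ^+ 2 / lam.
Proof.
have P1 := poisson_pmf_gt0 v.+1.
rewrite stein_cdfE// mulrA ler_pdivrMr// mulrAC ler_pdivlMr//.
have [lv|/ltW lv] := leP lam v.+1%:R.
  have b0 := upper_excess_ge0 v.+1; have T0 := poisson_ccdf_ge0 v.+1.
  have TP : poisson_ccdf v.+1 <= lam * p v.+1.
    have : 1 <= v.+2%:R - lam by rewrite -natr1; lra.
    move=> /(ler_wpM2r T0); move: b0; rewrite /upper_excess; lra.
  apply: (@le_trans _ _ (lam * p v.+1 * lam)).
    apply: ler_wpM2r; first exact: ltW.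
    apply: le_trans TP; rewrite ler_piMl ?poisson_cdf_le1//.
  rewrite mulrAC; apply: ler_wpM2r => //.
  by rewrite -expr2 ler_pXn2r// nnegrE// ltW.
have : poisson_cdf v <= v.+1%:R * p v.
  rewrite /poisson_cdf mulr_natl -[X in _ *+ X]subn0 -sumr_const_nat.
  apply: ler_sum_nat => k /andP[_ kv]; apply: poisson_pmf_nondec => //.
  by apply: le_trans lv; rewrite ler_nat.
move=> FP; apply: (@le_trans _ _ (v.+1%:R * p v * lam)).
  apply: ler_wpM2r; first exact: ltW.
  by apply: le_trans FP; rewrite ler_piMr ?poisson_cdf_ge0 ?poisson_ccdf_le1.
by rewrite -mulrA [p v * lam]mulrC -poisson_pmfS mulrA expr2.
Qed.

End Poisson.

(** * Expectations of functions of a countable variable *)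

Section CountableVariable.
Set Implicit Arguments.
Unset Strict Implicit.
Context {d} {T : measurableType d} {R : realType} (P : probability T R).

Lemma measurable_countable_comp (I : countType) (V : T -> I) (h : I -> R) :
  (forall i, measurable (V @^-1` [set i])) -> measurable_fun setT (h \o V).
Proof.
move=> mV _ Y mY; rewrite setTI.
rewrite (_ : _ @^-1` _ = \bigcup_i (V @^-1` [set i] `&` [set w | Y (h i)])).
  apply: countable_bigcupT_measurable => [|i]; first exact: countableP.
  apply: measurableI => //; have [Yh|Yh] := pselect (Y (h i)).
    by rewrite (_ : [set w | _] = setT)//; apply/seteqP; split.
  by rewrite (_ : [set w | _] = set0)//; apply/seteqP; split.
apply/seteqP; split => [w /= Yw|w [i _ /= [<-]]//].
by exists (V w).
Qed.

Section Series.
Variables (I : countType) (V : T -> I) (e : nat -> I).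
Hypotheses (mV : forall i, measurable (V @^-1` [set i])) (inj_e : injective e).

Let term (h : I -> R) k w : R := h (e k) * \1_(V @^-1` [set e k]) w.

Let term_sum h N w k0 : V w = e k0 ->
  \sum_(0 <= k < N) term h k w = if (k0 < N)%N then h (V w) else 0.
Proof.
move=> Vw; transitivity (\sum_(0 <= k < N | k == k0) h (e k)).
  rewrite [RHS]big_mkcond; apply: eq_bigr => k _.
  rewrite /term indicE; have [->|kk0] := eqVneq k k0.
    by rewrite mem_set ?mulr1.
  by rewrite memNset ?mulr0//= Vw => /inj_e kE; rewrite kE eqxx in kk0.
by rewrite big_nat1_eq /= Vw.
Qed.

Let term_sum0 h N w : (forall k, V w <> e k) -> \sum_(0 <= k < N) term h k w = 0.
Proof.
move=> Vw; apply: big1 => k _; rewrite /term indicE memNset ?mulr0//.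
exact: Vw.
Qed.

(** The enumeration [e] lists the values at which [h] may be nonzero: it is the
    identity for a natural-valued variable, and [Posz] for an integer-valued one
    when [h] vanishes on the negative integers. *)
Lemma expectation_series (h : I -> R) :
  (forall i, (forall k, i <> e k) -> h i = 0) ->
  P.-integrable setT (EFin \o (h \o V)) ->
  (fun N => \sum_(0 <= k < N) h (e k) * fine (P (V @^-1` [set e k]))) @ \oo -->
  \int[P]_w h (V w).
Proof.
move=> h0 ih.
have iterm k : P.-integrable setT (fun w => (term h k w)%:E).
  rewrite /term; under eq_fun do rewrite EFinM.
  by apply: integrableZl => //; exact: integrable_indic.
pose s N w := \sum_(0 <= k < N) (term h k w)%:E.
have is_ N : P.-integrable setT (s N) by exact: integrable_sum.
have sE N w : s N w = (\sum_(0 <= k < N) term h k w)%:E by rewrite -sumEFin.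
have cs w : s ^~ w @ \oo --> (h (V w))%:E.
  under eq_fun do rewrite sE; have [[k0 Vw]|nV] := pselect (exists k, V w = e k).
    apply: cvg_near_cst; exists k0.+1 => // N /= kN.
    by rewrite (term_sum _ _ Vw) kN.
  have nVw k : V w <> e k by move=> E; apply: nV; exists k.
  rewrite h0//; under eq_fun do rewrite term_sum0//.
  exact: cvg_cst.
have bs N w : (`|s N w| <= `|(h (V w))%:E|)%E.
  rewrite sE /= lee_fin; have [[k0 Vw]|nV] := pselect (exists k, V w = e k).
    by rewrite (term_sum _ _ Vw); case: ifP; rewrite ?normr0.
  by rewrite term_sum0 ?normr0// => k E; apply: nV; exists k.
have [_ _] := @dominated_convergence _ _ _ P setT measurableT s (fun w => (h (V w))%:E)
  (fun w => `|(h (V w))%:E|%E) (fun N => measurable_int _ (is_ N)) (measurable_int _ ih)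
  (aeW _ (fun w _ => cs w)) (integrable_abse ih) (aeW _ (fun w N _ => bs N w)).
have iE N : (\int[P]_w s N w = (\sum_(0 <=
  k < N) h (e k) * fine (P (V @^-1` [set e k])))%:E)%E.
  rewrite integral_sum// -sumEFin; apply: eq_bigr => k _.
  rewrite /term; under eq_integral do rewrite EFinM.
  rewrite integralZl//; last exact: integrable_indic.
  by rewrite integral_indic// setIT EFinM fineK// fin_num_measure.
under eq_fun do rewrite iE.
rewrite -[X in _ --> X]fineK; last exact: integrable_fin_num.
by move/fine_cvgP => [_].
Qed.

End Series.

Lemma integrable_bounded (h : T -> R) (M : R) : measurable_fun setT h ->
  (forall w, `|h w| <= M) -> P.-integrable setT (EFin \o h).
Proof.
move=> mh hM; apply: (le_integrable measurableT (g := EFin \o cst M)) => //.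
- exact/measurable_EFinP.
- by move=> w _ /=; rewrite lee_fin (le_trans (hM w))// ler_norm.
- exact: finite_measure_integrable_cst.
Qed.

Lemma integrable_of_mean_series (X : {RV P >-> nat}) (B : R) :
  (forall N, \sum_(0 <= k < N) k%:R * fine (P (X @^-1` [set k])) <= B) ->
  P.-integrable setT (fun w => ((X w)%:R : R)%:E).
Proof.
move=> sB.
have mX k : measurable (X @^-1` [set k]) by exact: measurable_funPTI.
have mXr : measurable_fun setT (fun w => (X w)%:R : R).
  exact: (@measurable_countable_comp nat X (fun k => k%:R)).
apply/integrableP; split; first exact/measurable_EFinP.
have TE : setT = \bigcup_k (X @^-1` [set k]).
  by apply/seteqP; split => // w _; exists (X w).
have tX : trivIset setT (fun k => X @^-1` [set k]).
  by move=> i j _ _ [w /= [<- <-]].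
rewrite {1}TE ge0_integral_bigcup//; last first.
  by apply/measurableT_comp => //; rewrite -TE; exact/measurable_EFinP.
apply: (@le_lt_trans _ _ B%:E); last exact: ltry.
apply: lime_le.
  by apply: is_cvg_nneseries => n _ _; exact: integral_ge0.
apply: nearW => N.
apply: le_trans (_ : (\sum_(0 <= k < N) k%:R * fine (P (X @^-1` [set k])))%:E <= _)%E.
  rewrite -sumEFin; apply: lee_sum => k _.
  rewrite (eq_integral (cst (k%:R)%:E)).
    by rewrite integral_cst// EFinM fineK// fin_num_measure.
  by move=> w; rewrite inE /= => ->; rewrite normr_nat.
by rewrite lee_fin.
Qed.

End CountableVariable.

(** * The Stein identity for the pair (X, Z) *)

Section IntegerExtension.
Set Implicit Arguments.
Unset Strict Implicit.
Context {R : realType}.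
Implicit Types (f : nat -> R) (M : R).

Lemma dist_le_steps f M i : (forall k, (i <= k)%N -> `|f k.+1 - f k| <= M) ->
  forall j k, (i <= j)%N -> (i <= k)%N -> `|f j - f k| <= M * `|j%:Z - k%:Z|%:~R.
Proof.
move=> step.
have up j n : (i <= j)%N -> `|f (j + n)%N - f j| <= M * n%:R.
  move=> ij; elim: n => [|n IH]; first by rewrite addn0 subrr normr0 mulr0.
  rewrite addnS -natr1 mulrDr mulr1 [leRHS]addrC.
  rewrite -[X in `|X|](subrKA (f (j + n)%N)); apply: (le_trans (ler_normD _ _)).
  by apply: lerD => //; apply: step; rewrite (leq_trans ij)// leq_addr.
move=> j k ij ik; have [jk|/ltnW kj] := leqP j k.
  rewrite distrC -{1}(subnKC jk) (le_trans (up _ _ ij))//.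
  by rewrite distrC subzn.
by rewrite -{1}(subnKC kj) (le_trans (up _ _ ik))// subzn.
Qed.

(** Extending by zero absorbs the indicator of [X + Z >= 0] that appears when
    [i P(X = i)] is replaced by [lam P(X + Z = i - 1)]. *)
Definition int_ext f (z : int) : R := if z is Posz n then f n else 0.

Lemma int_ext_lipschitz f M : f 0 = 0 -> (forall k, `|f k.+1 - f k| <= M) ->
  forall x y : int, `|int_ext f x - int_ext f y| <= M * `|x - y|%:~R.
Proof.
move=> f0 step; have M0 : 0 <= M := le_trans (normr_ge0 _) (step 0%N).
have D := @dist_le_steps f M 0 (fun k _ => step k).
have E n : `|f n| <= M * n%:R by have := D n 0%N isT isT; rewrite f0 !subr0.
case=> [m|m] [n|n] /=; first exact: D.
- rewrite subr0 (le_trans (E m))//; apply: ler_wpM2l => //.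
  by rewrite NegzE opprK -PoszD /= ler_nat leq_addr.
- rewrite sub0r normrN (le_trans (E n))//; apply: ler_wpM2l => //.
  by rewrite NegzE -opprD normrN -PoszD /= ler_nat leq_addl.
- by rewrite subr0 normr0 mulr_ge0// ler0z.
Qed.

End IntegerExtension.

Section SteinIdentity.
Set Implicit Arguments.
Unset Strict Implicit.
Context {R : realType} {d} {T : measurableType d} (P : probability T R).
Variables (lam : R) (X : {RV P >-> nat}) (Z : {RV P >-> int}) (q : nat -> R).
Hypothesis lam_gt0 : 0 < lam.
Hypothesis q_def : forall i : nat, (1 <= i)%N ->
     ((q i.-1)%:E = i%:R%:E * P [set w | X w = i]
       - lam%:E * P [set w | ((X w)%:Z + Z w = i%:Z - 1)%R])%E.

Let V w : int := (X w)%:Z + Z w.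
Let XZ w := (X w, Z w).

Lemma measurable_pair_fiber i : measurable (XZ @^-1` [set i]).
Proof.
case: i => k z; rewrite (_ : _ @^-1` _ = (X @^-1` [set k]) `&` (Z @^-1` [set z])).
  by apply: measurableI; exact: measurable_funPTI.
by apply/seteqP; split => [w [<- <-]|w [/= <- <-]].
Qed.

Lemma measurable_pair_comp (h : nat -> int -> R) :
  measurable_fun setT (fun w => h (X w) (Z w)).
Proof.
exact: (measurable_countable_comp (V := XZ) (fun i => h i.1 i.2) measurable_pair_fiber).
Qed.

Lemma measurable_X_fiber k : measurable (X @^-1` [set k]).
Proof. exact: measurable_funPTI. Qed.

Lemma measurable_V_fiber z : measurable (V @^-1` [set z]).
Proof.
pose h (k : nat) (y : int) : R := (k%:Z + y == z)%:R.
rewrite (_ : _ @^-1` _ = (fun w => h (X w) (Z w)) @^-1` [set 1]).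
  by rewrite -[X in measurable X]setTI; exact: measurable_pair_comp.
apply/seteqP; split => w /=; rewrite /h; first by move=> <-; rewrite eqxx.
by case: eqP => [//|_ /eqP]; rewrite eq_sym oner_eq0.
Qed.

Let X_pmf k : R := fine (P (X @^-1` [set k])).
Let V_pmf k : R := fine (P (V @^-1` [set Posz k])).

Lemma q_pmfE k : q k = k.+1%:R * X_pmf k.+1 - lam * V_pmf k.
Proof.
have := q_def (isT : (1 <= k.+1)%N); rewrite /=.
have -> : k.+1%:Z - 1 = Posz k by rewrite -addn1 PoszD addrK.
rewrite -[P [set w | X w = k.+1]]fineK; last by rewrite fin_num_measure//;
  exact: measurable_X_fiber.
rewrite -[P [set w | _ = Posz k]]fineK; last by rewrite fin_num_measure//;
  exact: measurable_V_fiber.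
by rewrite -!EFinM -EFinB => -[].
Qed.

Lemma Posz_inj : injective Posz.
Proof. by move=> m n []. Qed.

Lemma V_prob_sum_le1 N : \sum_(0 <= k < N) V_pmf k <= 1.
Proof.
pose h (z : int) : R := ((0 <= z)%R)%:R.
have ih : P.-integrable setT (EFin \o (h \o V)).
  apply: (@integrable_bounded _ _ _ _ _ 1).
    exact: measurable_countable_comp measurable_V_fiber.
  by move=> w; rewrite /h /= ger0_norm// lern1 leq_b1.
have h0 (z : int) : (forall k : nat, z <> Posz k :> int) -> h z = 0.
  by case: z => // k /(_ k).
have cv := expectation_series measurable_V_fiber Posz_inj h0 ih.
apply: (@le_trans _ _ (\int[P]_w h (V w))); last first.
  rewrite (_ : 1 = \int[P]_w (cst 1 w : R)).
    apply: le_Rintegral => //; first exact: finite_measure_integrable_cst.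
    by move=> w _; rewrite /h lern1 leq_b1.
  by rewrite Rintegral_cst// (congr1 fine (probability_setT P)) mul1r.
rewrite -(cvg_lim (@Rhausdorff R) cv).
rewrite (eq_bigr (fun k => h (Posz k) * fine (P (V @^-1` [set Posz k])))); last first.
  by move=> k _; rewrite mul1r.
apply: (nondecreasing_cvgn_le (u_ :=
  fun N => \sum_(0 <= k < N) h (Posz k) * fine (P (V @^-1` [set Posz k])))).
  apply/nondecreasing_seqP => n; rewrite big_nat_recr //= lerDl.
  by rewrite mulr_ge0// fine_ge0.
exact: cvgP cv.
Qed.

(** Summing the definition of [q] bounds the mean of [X] by
    [sum |q i| + lam]. *)
Lemma integrable_X : (\sum_(0 <= i <oo) `|q i|%:E < +oo)%E ->
  P.-integrable setT (fun w => ((X w)%:R : R)%:E).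
Proof.
move=> q_fin.
pose S := (\sum_(0 <= i <oo) `|q i|%:E)%E.
have S_fin : S \is a fin_num.
  by rewrite ge0_fin_numE// nneseries_ge0// => i _ _; rewrite lee_fin.
apply: (@integrable_of_mean_series _ _ _ _ _ (fine S + lam)) => N.
apply: (@le_trans _ _ (\sum_(0 <= k < N.+1) k%:R * X_pmf k)).
  by rewrite big_nat_recr //= lerDl mulr_ge0// fine_ge0.
rewrite big_nat_recl //= mul0r add0r.
apply: (@le_trans _ _ (\sum_(0 <= k < N) (`|q k| + lam * V_pmf k))).
  apply: ler_sum => k _; have := q_pmfE k => /eqP; rewrite eq_sym subr_eq => /eqP ->.
  by rewrite lerD2r ler_norm.
rewrite big_split /= -mulr_sumr; apply: lerD.
  rewrite -lee_fin fineK// -sumEFin; apply: nneseries_lim_ge => i _ _.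
  by rewrite lee_fin.
by rewrite ler_piMr ?(ltW lam_gt0)// V_prob_sum_le1.
Qed.

Section Solution.
Variables (g f : nat -> R) (c M : R).
Hypothesis f_eq : forall k, lam * f k.+1 = k%:R * f k + (g k - c).
Hypotheses (f0 : f 0%N = 0) (f_le : forall k, `|f k| <= M).
Hypothesis q_fin : (\sum_(0 <= i <oo) `|q i|%:E < +oo)%E.

Lemma int_ext_le z : `|int_ext f z| <= M.
Proof. by case: z => n //=; rewrite normr0 (le_trans _ (f_le 0)). Qed.

Let gE w : g (X w) = c + (lam * f (X w).+1 - (X w)%:R * f (X w)).
Proof. by rewrite f_eq; ring. Qed.

Let i1 : P.-integrable setT (EFin \o (fun w => f (X w).+1)).
Proof.
apply: (@integrable_bounded _ _ _ _ _ M) => //.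
exact: (measurable_countable_comp (fun k => f k.+1) measurable_X_fiber).
Qed.

Let i2 : P.-integrable setT (EFin \o (fun w => (X w)%:R * f (X w))).
Proof.
apply: (le_integrable measurableT (g := fun w => (M%:E * ((X w)%:R : R)%:E)%E)).
- apply/measurable_EFinP.
  exact: (measurable_countable_comp (fun k => k%:R * f k) measurable_X_fiber).
- move=> w _ /=; rewrite lee_fin normrM normr_nat mulrC normrM normr_nat.
  by rewrite ler_wpM2r// (le_trans (f_le _))// ler_norm.
- by apply: integrableZl => //; exact: integrable_X.
Qed.

Let i3 : P.-integrable setT (EFin \o (fun w => int_ext f (V w + 1))).
Proof.
apply: (@integrable_bounded _ _ _ _ _ M); last by move=> w; exact: int_ext_le.
exact: (measurable_countable_comp (fun z => int_ext f (z + 1)) measurable_V_fiber).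
Qed.

(** The mean of [X f(X)] is expanded along the values of [X], and
    [(i + 1) P(X = i + 1)] is replaced by [q i + lam P(X + Z = i)]. *)
Lemma stein_identity :
  (fun N => \sum_(0 <= i < N) q i * f i.+1) @ \oo -->
  lam * \int[P]_w (f (X w).+1 - int_ext f (V w + 1)) - (\int[P]_w g (X w) - c).
Proof.
have i1' : P.-integrable setT (EFin \o (fun w => lam * f (X w).+1)).
  rewrite (_ : _ \o _ = fun w => (lam%:E * (f (X w).+1)%:E)%E); first exact: integrableZl.
  by apply/funext.
have -> : \int[P]_w g (X w) =
    c + (lam * \int[P]_w f (X w).+1 - \int[P]_w ((X w)%:R * f (X w))).
  under eq_Rintegral do rewrite gE.
  rewrite (RintegralD (f1 := cst c)) //=; [|exact: finite_measure_integrable_cst|].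
    by rewrite Rintegral_cst// (congr1 fine (probability_setT P)) mulr1 RintegralB//
      RintegralZl.
  rewrite (_ : _ \o _ = (fun w => (lam * f (X w).+1)%:E - ((X w)%:R * f (X w))%:E)%E).
    exact: integrableB.
  by apply/funext.
rewrite RintegralB//.
rewrite (_ : _ - _ = \int[P]_w ((X w)%:R * f (X w)) - lam * \int[P]_w int_ext f (V w
  + 1)); last by ring.
have hX i : (forall k, i <> id k) -> i%:R * f i = 0 :> R by move/(_ i).
have := expectation_series (h := fun k => k%:R
  * f k) measurable_X_fiber (@inj_id nat) hX i2.
rewrite -cvg_shiftS => /= c2.
have hV z : (forall k, z <> Posz k) -> int_ext f (z + 1) = 0.
  case: z => [k /(_ k)//|[|n] _]; first by rewrite NegzE addNr.
  by rewrite NegzE -addn1 PoszD opprD subrK.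
have c3 := expectation_series (h :=
  fun z => int_ext f (z + 1)) measurable_V_fiber Posz_inj hV i3.
rewrite (_ : (fun N => _) = (fun N => \sum_(0 <= k < N.+1) k%:R * f k * X_pmf k
    - lam * \sum_(0 <= k < N) int_ext f (Posz k + 1) * V_pmf k)).
  by apply: cvgB => //; apply: cvgM => //; exact: cvg_cst.
apply/funext => N; rewrite big_nat_recl //= mul0r mul0r add0r mulr_sumr -sumrB.
by apply: eq_bigr => k _; rewrite q_pmfE addn1; ring.
Qed.

Lemma stein_bound :
  (`|\int[P]_w g (X w) - c|%:E <=
   lam%:E * \int[P]_w (`|f (X w).+1 - int_ext f (V w + 1)|%:E)
   + \sum_(0 <= i <oo) (`|q i| * `|f i.+1|)%:E)%E.
Proof.
set s := (X in (_ <= _ + X)%E); set I := (X in (_ <= _ * X + _)%E).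
have iI : P.-integrable setT (EFin \o (fun w => f (X w).+1 - int_ext f (V w + 1))).
  rewrite (_ : _ \o _ = (fun w => (f (X w).+1)%:E - (int_ext f (V w + 1))%:E)%E).
    exact: integrableB.
  by apply/funext.
have I_fin : I \is a fin_num by exact: (integrable_fin_num measurableT (integrable_abse
  iI)).
have [->|s_fin] := eqVneq s +oo%E; first by rewrite -(fineK I_fin) -EFinM addey// leey.
have s0 : (0 <= s)%E by apply: nneseries_ge0 => i _ _; rewrite lee_fin mulr_ge0.
have {}s_fin : s \is a fin_num by rewrite ge0_fin_numE// lt_neqAle s_fin leey.
rewrite -(fineK s_fin) -(fineK I_fin) -EFinM -EFinD lee_fin.
have := stein_identity; set u := (X in X - _) => cv.
have ub : `|u| <= lam * fine I.
  rewrite /u normrM (gtr0_norm lam_gt0) ler_pM2l//.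
  exact: le_normr_Rintegral.
have : `|u - (\int[P]_w g (X w) - c)| <= fine s.
  have cvn : (fun N => `|\sum_(0 <= i < N) q i * f i.+1|) @ \oo -->
      `|u - (\int[P]_w g (X w) - c)| by exact: cvg_norm.
  apply: (ler_limit cvn (cvg_cst (fine s))) => N.
  rewrite -lee_fin fineK//; apply: le_trans (nneseries_lim_ge N _) => [|i _ _].
    by rewrite sumEFin lee_fin (le_trans (ler_norm_sum _ _ _))//; apply: ler_sum => i _;
      rewrite normrM.
  by rewrite lee_fin mulr_ge0.
move=> h; rewrite -[X in `|X|](subKr u) (le_trans (ler_normB _ _))// lerD//.
Qed.

End Solution.

End SteinIdentity.

(** * Distance bounds *)

Section PoissonVariable.
Set Implicit Arguments.
Unset Strict Implicit.
Context {R : realType} {d} {T : measurableType d} (Q : probability T R).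

Lemma prob_preimage (X : {RV Q >-> nat}) (b : nat -> bool) :
  Q [set w | b (X w)] = (\int[Q]_w (b (X w))%:R)%:E.
Proof.
have mA : measurable [set w | b (X w)].
  rewrite (_ : [set w | _] = X @^-1` [set k | b k])//; exact: measurable_funPTI.
rewrite (_ : \int[Q]_w _ = \int[Q]_w \1_[set w | b (X w)] w).
  by rewrite /Rintegral integral_indic// setIT fineK// fin_num_measure.
apply: eq_Rintegral => w _; rewrite indicE.
case: (boolP (b (X w))) => bX; first by rewrite mem_set.
by rewrite memNset//=; apply/negP.
Qed.

Lemma integrable_ind (X : {RV Q >-> nat}) (b : nat -> bool) :
  Q.-integrable setT (EFin \o ((fun k => (b k)%:R) \o X)).
Proof.
apply: (@integrable_bounded _ _ _ _ _ 1).
  by apply: measurable_countable_comp => i; exact: measurable_funPTI.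
by move=> w /=; rewrite normr_nat lern1 leq_b1.
Qed.

Lemma integrable_lip (X : {RV Q >-> nat}) (g : nat -> R) : Lip1 g ->
  Q.-integrable setT (fun w => ((X w)%:R : R)%:E) -> Q.-integrable setT (EFin \o (g \o X)).
Proof.
move=> gLip iX.
apply: (le_integrable measurableT (g := fun w => (`|g 0%N|%:E + ((X w)%:R : R)%:E)%E)).
- apply/measurable_EFinP; apply: measurable_countable_comp => i.
  exact: measurable_funPTI.
- move=> w _ /=; rewrite lee_fin [leRHS]ger0_norm ?addr_ge0//.
  rewrite -[g (X w)](subrK (g 0%N)) addrC (le_trans (ler_normD _ _))// lerD//.
  by apply: (le_trans (gLip _ _)); rewrite subr0 normr_nat.
- apply: integrableD => //.
  exact: finite_measure_integrable_cst.
Qed.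

Section Mean.
Variables (lam : R) (Y : {RV Q >-> nat}).
Hypotheses (lam_gt0 : 0 < lam) (Yp : is_poisson Q lam Y).

Lemma poisson_fiber k : fine (Q (Y @^-1` [set k])) = poisson_pmf lam k.
Proof.
have := Yp [set k]; rewrite /distribution /pushforward => ->.
by rewrite /poisson_prob lam_gt0 esum_set1// lee_fin poisson_pmf_ge0.
Qed.

Lemma poisson_variable_mean g : Q.-integrable setT (EFin \o (g \o Y)) ->
  has_poisson_mean lam g (\int[Q]_w g (Y w)).
Proof.
move=> ig; have mY i : measurable (Y @^-1` [set i]) by exact: measurable_funPTI.
have h0 i : (forall k, i <> id k) -> g i = 0 by move/(_ i).
have := expectation_series mY (@inj_id nat) h0 ig; rewrite /has_poisson_mean.
by under eq_fun do under eq_bigr do rewrite poisson_fiber mulrC.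
Qed.

Lemma integrable_poisson : Q.-integrable setT (fun w => ((Y w)%:R : R)%:E).
Proof.
apply: (@integrable_of_mean_series _ _ _ _ _ lam) => N.
under eq_bigr do rewrite poisson_fiber mulrC.
case: N => [|N]; first by rewrite big_geq// ltW.
rewrite poisson_pmf_sum_id// lerBlDr.
have l0 := ltW lam_gt0; have := poisson_cdf_le1 _ lam_gt0 N; rewrite /poisson_cdf => h.
by apply: (le_trans (ler_wpM2l l0 h)); rewrite mulr1 lerDl mulr_ge0// poisson_pmf_ge0.
Qed.

End Mean.
End PoissonVariable.

Section Bounds.
Set Implicit Arguments.
Unset Strict Implicit.
Context {R : realType} {d} {T : measurableType d} (P : probability T R).
Variables (lam : R) (X : {RV P >-> nat}) (Z : {RV P >-> int}) (q : nat -> R).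
Hypothesis lam_gt0 : 0 < lam.
Hypothesis q_def : forall i : nat, (1 <= i)%N ->
     ((q i.-1)%:E = i%:R%:E * P [set w | X w = i]
       - lam%:E * P [set w | ((X w)%:Z + Z w = i%:Z - 1)%R])%E.

Lemma expectationE (W : T -> R) : ('E_P[W] = \int[P]_w (W w)%:E)%E.
Proof. by rewrite unlock. Qed.

Lemma measurable_pair_pred (b : nat -> int -> bool) :
  measurable [set w | b (X w) (Z w)].
Proof.
rewrite (_ : [set w | _] = (fun w => (b (X w) (Z w))%:R : R) @^-1` [set 1]).
  rewrite -[X in measurable X]setTI.
  exact: (measurable_pair_comp X Z (fun k z => (b k z)%:R)).
apply/seteqP; split => w /=; first by move=> ->.
by case: (b _ _) => // /eqP; rewrite eq_sym oner_eq0.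
Qed.

Lemma stein_bound_of_le (g f : nat -> R) (c M : R) (W : T -> R) :
  (forall k, lam * f k.+1 = k%:R * f k + (g k - c)) ->
  f 0%N = 0 -> (forall k, `|f k| <= M) ->
  (\sum_(0 <= i <oo) `|q i|%:E < +oo)%E ->
  measurable_fun setT W -> (forall w, 0 <= W w) ->
  {ae P, forall w, lam * `|f (X w).+1 - int_ext f ((X w)%:Z + Z w + 1)| <= W w} ->
  (`|\int[P]_w g (X w) - c|%:E <=
     'E_P[W] + \sum_(0 <= i <oo) (`|q i| * `|f i.+1|)%:E)%E.
Proof.
move=> f_eq f0 fM q_fin mW W0 DW.
apply: (le_trans (stein_bound lam_gt0 q_def f_eq f0 fM q_fin)).
rewrite leeD2r// expectationE.
have mD : measurable_fun setT (fun w => `|f (X w).+1 - int_ext f ((X w)%:Z + Z w + 1)|).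
  exact: (measurable_pair_comp X Z (fun k z => `|f k.+1 - int_ext f (k%:Z + z + 1)|)).
rewrite -ge0_integralZl//; last 2 first.
- exact/measurable_EFinP.
- by rewrite lee_fin ltW.
apply: ae_ge0_le_integral => //.
- by move=> w _; rewrite -EFinM lee_fin mulr_ge0// ltW.
- under eq_fun do rewrite -EFinM; apply/measurable_EFinP.
  by apply: measurable_funM => //; exact: measurable_cst.
- by move=> w _; rewrite lee_fin.
- exact/measurable_EFinP.
- by apply: filterS DW => w + _; rewrite -EFinM lee_fin.
Qed.

Lemma measurable_absZ : measurable_fun setT (fun w => `|(Z w)%:~R| : R).
Proof. exact: (measurable_pair_comp X Z (fun k z => `|z%:~R|)). Qed.

Lemma expectation_absZ (c : R) : 0 <= c ->
  ('E_P[fun w => (c * `|(Z w)%:~R|)%R] = c%:E * 'E_P[fun w => `|(Z w)%:~R|%R])%E.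
Proof.
move=> c0; rewrite !expectationE -ge0_integralZl//.
by apply/measurable_EFinP; exact: measurable_absZ.
Qed.

Lemma series_bound (u : nat -> R) C : (forall i, `|u i| <= C) ->
  (\sum_(0 <= i <oo) (`|q i| * `|u i|)%:E <= C%:E * \sum_(0 <= i <oo) `|q i|%:E)%E.
Proof.
move=> uC; rewrite -nneseriesZl//.
apply: lee_nneseries => [i _ _|i _]; first by rewrite lee_fin mulr_ge0.
by rewrite -EFinM lee_fin mulrC ler_wpM2r.
Qed.


Lemma int_ext_scaled (f : nat -> R) M : f 0%N = 0 ->
  (forall k, lam * `|f k.+1 - f k| <= M) -> forall n z,
  lam * `|f n.+1 - int_ext f (n%:Z + z + 1)| <= M * `|z%:~R|.
Proof.
move=> f0 step n z.
have l0 := ltW lam_gt0.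
have sc (a b : R) : lam * `|a - b| = `|lam * a - lam * b|.
  by rewrite -mulrBr normrM ger0_norm.
have step' k : `|lam * f k.+1 - lam * f k| <= M by rewrite -sc.
have F0 : lam * f 0%N = 0 by rewrite f0 mulr0.
have := @int_ext_lipschitz _ (fun k => lam * f k) M F0 step' (Posz n.+1) (n%:Z + z + 1).
have -> : Posz n.+1 - (n%:Z + z + 1) = - z by rewrite -addn1 PoszD; ring.
rewrite normrN intr_norm sc /=.
by case: (n%:Z + z + 1) => k //=; rewrite mulr0.
Qed.

(** When [n + z >= 0] both arguments are positive, so the step of [f] from [0] to
    [1], which does not come from the Stein equation, is never crossed. *)
Lemma dist_scaled (f : nat -> R) M : (forall k, (0 < k)%N -> lam * `|f k.+1 - f k| <= M) ->
  forall n z, 0 <= n%:Z + z ->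
  lam * `|f n.+1 - int_ext f (n%:Z + z + 1)| <= M * `|z%:~R|.
Proof.
move=> step n z; case E : (n%:Z + z) => [k|//] _.
have zE : z = k%:Z - n%:Z by rewrite -E addrC addKr.
have l0 := ltW lam_gt0.
have sc (a b : R) : lam * `|a - b| = `|lam * a - lam * b|.
  by rewrite -mulrBr normrM ger0_norm.
have step' j : (1 <= j)%N -> `|lam * f j.+1 - lam * f j| <= M by rewrite -sc; exact: step.
have := @dist_le_steps _ (fun k => lam * f k) M 1 step' n.+1 k.+1 isT isT.
rewrite -sc /= addn1 -intr_norm; congr (_ <= _ * _%:~R).
by rewrite zE distrC; congr `|_|; lia.
Qed.

Context {d'} {T' : measurableType d'} (Q : probability T' R).
Variable (Y : {RV Q >-> nat}).
Hypothesis Yp : is_poisson Q lam Y.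
Hypothesis q_fin : (\sum_(0 <= i <oo) `|q i|%:E < +oo)%E.

Let ind_mean (b : nat -> bool) :
  has_poisson_mean lam (fun k => (b k)%:R) (\int[Q]_w (b (Y w))%:R).
Proof. exact: (poisson_variable_mean lam_gt0 Yp (integrable_ind Y b)). Qed.

Let c1_ge0 : 0 <= Num.min 1 lam.
Proof. by rewrite le_min ler01 ltW. Qed.

Let stein_le1 (b : nat -> bool) k :
  `|stein lam (fun k => (b k)%:R) (\int[Q]_w (b (Y w))%:R) k| <= 1.
Proof.
case: k => [|k]; first by rewrite /= normr0.
exact: (@stein_ind_le1 _ _ lam_gt0 _ _ k (@ind_mean b)).
Qed.

Lemma event_bound (b : nat -> bool) :
  (`|P [set w | b (X w)] - Q [set w | b (Y w)]| <=
    (Num.min 1 lam)%:E * 'E_P[fun w => `|(Z w)%:~R|%R]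
    + (Num.min 1 (Num.sqrt lam)^-1)%:E * \sum_(0 <= i <oo) `|q i|%:E)%E.
Proof.
rewrite !prob_preimage -EFinB abse_EFin.
set c := \int[Q]_w _; pose f := stein lam (fun k => (b k)%:R) c.
rewrite -expectation_absZ//.
apply: (le_trans (stein_bound_of_le (g := fun k => (b k)%:R) (f := f) (M := 1)
  (W := fun w => Num.min 1 lam * `|(Z w)%:~R|) _ _ _ _ _ _ _)) => //.
- by move=> k; exact: stein_eq.
- exact: stein_le1.
- by apply: measurable_funM => //; exact: measurable_absZ.
- by move=> w; rewrite mulr_ge0.
- apply: aeW => w; apply: int_ext_scaled => // k.
  exact: (@stein_ind_step _ _ lam_gt0 _ _ k (@ind_mean b)).
- rewrite leeD2l//; apply: (@series_bound (fun i => f i.+1)) => i.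
  exact: (@stein_ind_le _ _ lam_gt0 _ _ i (@ind_mean b)).
Qed.

Lemma expectation_lip d0 (T0 : measurableType d0) (P0 : probability T0 R)
    (X0 : {RV P0 >-> nat}) (g : nat -> R) : Lip1 g ->
  P0.-integrable setT (fun w => ((X0 w)%:R : R)%:E) ->
  ('E_P0[g \o X0] = (\int[P0]_w g (X0 w))%:E)%E.
Proof.
move=> gLip iX; rewrite unlock fineK//.
exact: (integrable_fin_num measurableT (integrable_lip gLip iX)).
Qed.

(** The series of [q] enters with coefficient [1] because the solution is bounded
    by [1]; the bound [M] on the increments is the part that depends on whether
    [X + Z] can be negative. *)
Lemma wasserstein_test (g : nat -> R) (M : R) : Lip1 g -> 0 <= M ->
  let f := stein lam g (\int[Q]_w g (Y w)) in
  {ae P, forall w, lam * `|f (X w).+1 - int_ext f ((X w)%:Z + Z w + 1)| <=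
    M * `|(Z w)%:~R|} ->
  (`|'E_P[g \o X] - 'E_Q[g \o Y]| <=
     M%:E * 'E_P[fun w => `|(Z w)%:~R|%R] + \sum_(0 <= i <oo) `|q i|%:E)%E.
Proof.
move=> gLip M0 f Df.
have iX := integrable_X lam_gt0 q_def q_fin; have iY := integrable_poisson lam_gt0 Yp.
rewrite (expectation_lip gLip iX) (expectation_lip gLip iY) -EFinB abse_EFin.
have gc := poisson_variable_mean lam_gt0 Yp (integrable_lip gLip iY).
rewrite -expectation_absZ// -[X in (_ <= _ + X)%E]mul1e.
have f1 k : `|f k.+1| <= 1 by exact: stein_lip_bound.
apply: (le_trans (stein_bound_of_le (g := g) (f := f) (M := 1)
  (W := fun w => M * `|(Z w)%:~R|) _ _ _ _ _ _ _)) => //.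
- by move=> k; exact: stein_eq.
- by case=> [|k] //; rewrite /= normr0.
- by apply: measurable_funM => //; exact: measurable_absZ.
- by move=> w; rewrite mulr_ge0.
- by rewrite leeD2l//; exact: (@series_bound (fun i => f i.+1)).
Qed.

Lemma wasserstein_bound (g : nat -> R) : Lip1 g ->
  (`|'E_P[g \o X] - 'E_Q[g \o Y]| <=
     lam%:E * 'E_P[fun w => `|(Z w)%:~R|%R] + \sum_(0 <= i <oo) `|q i|%:E)%E.
Proof.
move=> gLip; apply: wasserstein_test => //; first exact: ltW.
apply: aeW => w; apply: int_ext_scaled => // k.
rewrite ler_piMr ?(ltW lam_gt0)//; apply: stein_lip_step => //.
exact: (poisson_variable_mean lam_gt0 Yp (integrable_lip gLip (integrable_poisson lam_gt0
  Yp))).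
Qed.

Section Nonneg.
Hypothesis VP : P [set w | (0 <= (X w)%:Z + Z w)%R] = 1%E.

Lemma ae_V_ge0 : {ae P, forall w, 0 <= (X w)%:Z + Z w}.
Proof.
have mA := measurable_pair_pred (fun k z => 0 <= k%:Z + z).
exists (~` [set w | (0 <= (X w)%:Z + Z w)%R]); split => //.
- exact: measurableC.
- by rewrite probability_setC// VP subee.
Qed.

Lemma wasserstein_bound_nonneg (g : nat -> R) : Lip1 g ->
  (`|'E_P[g \o X] - 'E_Q[g \o Y]| <=
     (Num.min (11437 / 10000 * Num.sqrt lam) lam)%:E * 'E_P[fun w => `|(Z w)%:~R|%R]
     + \sum_(0 <= i <oo) `|q i|%:E)%E.
Proof.
move=> gLip.
have K0 : 0 <= 11437 / 10000 * Num.sqrt lam by apply: mulr_ge0; [lra|exact: sqrtr_ge0].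
have gc := poisson_variable_mean lam_gt0 Yp (integrable_lip gLip (integrable_poisson
  lam_gt0 Yp)).
have step k := @stein_lip_step_pos _ _ lam_gt0 g _ gc gLip k.
move: (11437 / 10000 * Num.sqrt lam) K0 step => K K0 step.
apply: wasserstein_test => //; first by rewrite le_min K0 ltW.
by apply: filterS ae_V_ge0 => w; exact: dist_scaled.
Qed.

(** [X - Z_-] is the smaller of [X] and [X + Z]. *)
Lemma sub_negpart (x n : nat) (z : int) : x%:Z + z = n%:Z ->
  x%:Z - negpart z = (minn x n)%:Z.
Proof. by rewrite /negpart /Num.max; case: ifPn; lia. Qed.

Let absZ_ge1 (z : int) : z != 0 -> 1 <= `|z%:~R| :> R.
Proof. by rewrite -intr_norm ler1z; lia. Qed.

Let K w : int := (X w)%:Z - negpart (Z w).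

Let measurable_K (A : set int) : measurable [set w | A (K w)].
Proof.
rewrite (_ : [set w | _] = [set w | `[< A ((X w)%:Z - negpart (Z w)) >]]).
  exact: (measurable_pair_pred (fun k z => `[< A (k%:Z - negpart z) >])).
by apply/seteqP; split => w /=; [move/asboolP|move/asboolP].
Qed.

Let measurable_absZ_indic (A : set T) : measurable A ->
  measurable_fun setT (fun w => `|(Z w)%:~R| * \1_A w : R).
Proof. by move=> mA; apply: measurable_funM;
  [exact: measurable_absZ|exact: measurable_indic]. Qed.

Let expectation_ge0D (A B : T -> R) : measurable_fun setT A -> measurable_fun setT B ->
  (forall w, 0 <= A w) -> (forall w, 0 <= B w) ->
  ('E_P[fun w => (A w + B w)%R] = 'E_P[A] + 'E_P[B])%E.
Proof.
move=> mA mB A0 B0; rewrite !expectationE.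
under eq_integral do rewrite EFinD.
by rewrite ge0_integralD//; try (by apply/measurable_EFinP); move=> w _; rewrite lee_fin.
Qed.

Let expectation_ge0_sum (c : nat -> R) (U : nat -> T -> R) m :
  (forall k, 0 <= c k) -> (forall k, measurable_fun setT (U k)) ->
  (forall k w, 0 <= U k w) ->
  ('E_P[fun w => (\sum_(0 <= k < m) c k * U k w)%R] =
    \sum_(0 <= k < m) (c k)%:E * 'E_P[U k])%E.
Proof.
move=> c0 mU U0; rewrite expectationE.
under eq_integral do rewrite -sumEFin.
rewrite ge0_integral_sum//; last 2 first.
- move=> k; apply/measurable_EFinP; apply: measurable_funM => //.
- by move=> k w _; rewrite lee_fin mulr_ge0.
apply: eq_bigr => k _; rewrite expectationE; under eq_integral do rewrite EFinM.
rewrite ge0_integralZl//; last by rewrite lee_fin.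
- exact/measurable_EFinP.
- by move=> w _; rewrite lee_fin.
Qed.

Lemma cdf_mean v : \int[Q]_w (Y w <= v)%N%:R = poisson_cdf lam v.
Proof.
have := @ind_mean (fun k => (k <= v)%N); rewrite /has_poisson_mean => h.
rewrite -(cvg_lim (@Rhausdorff R) h).
exact: (cvg_lim (@Rhausdorff R) (@has_poisson_mean_cdf_test _ lam v)).
Qed.

Let no_jump (f : nat -> R) w : Z w = 0 ->
  lam * `|f (X w).+1 - int_ext f ((X w)%:Z + Z w + 1)| = 0.
Proof. by move=> ->; rewrite addr0 -PoszD addn1 /= subrr normr0 mulr0. Qed.

(** The solution [f] is nonnegative and decreasing on the positive integers, so
    its values at [X + 1] and [X + Z + 1] differ by at most [f (K + 1)] with
    [K = X - Z_-]; the integer [|Z|] is at least [1] unless the two arguments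
    coincide.  The value [f (K + 1)] is estimated at [K] when [K < m], and by
    [f (m + 1)] otherwise. *)
Lemma prob_zero_bound (m : nat) :
  (`|P [set w | (X w <= 0)%N] - Q [set w | (Y w <= 0)%N]|
    <= (m`!%:R / lam ^+ m)%:E * 'E_P[fun w => `|(Z w)%:~R|%R]
       + \sum_(0 <= k < m)
           (Num.min (lam / k.+1%:R) (k`!%:R / lam ^+ k))%:E
           * 'E_P[fun w => (`|(Z w)%:~R| *
               \1_[set w | (X w)%:Z - negpart (Z w) = k%:Z] w)%R]
       + (Num.min 1 lam^-1)%:E * `|q 0%N|%:E
       + (Num.min 1 (lam ^+ 2)^-1)%:E * \sum_(1 <= i <oo) `|q i|%:E)%E.
Proof.
rewrite !(prob_preimage _ (fun k => (k <= 0)%N)) -EFinB abse_EFin cdf_mean.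
pose f := stein lam (fun k => (k <= 0)%N%:R) (poisson_cdf lam 0).
pose c k : R := Num.min (lam / k.+1%:R) (k`!%:R / lam ^+ k).
have l0 := ltW lam_gt0.
have c0 k : 0 <= c k by rewrite le_min !divr_ge0// exprn_ge0.
have cm : 0 <= m`!%:R / lam ^+ m by rewrite divr_ge0// exprn_ge0.
pose U k w : R := `|(Z w)%:~R| * \1_[set w | (X w)%:Z - negpart (Z w) = k%:Z] w.
have mU k : measurable_fun setT (U k).
  by apply: measurable_absZ_indic; exact: (measurable_K [set k%:Z]).
have U0 k w : 0 <= U k w by rewrite mulr_ge0.
pose W1 w : R := m`!%:R / lam ^+ m * `|(Z w)%:~R|.
pose W2 w : R := \sum_(0 <= k < m) c k * U k w.
have mW1 : measurable_fun setT W1 by apply: measurable_funM => //; exact: measurable_absZ.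
have mW2 : measurable_fun setT W2.
  by apply: measurable_sum => k; apply: measurable_funM.
have W10 w : 0 <= W1 w by rewrite mulr_ge0.
have W20 w : 0 <= W2 w by apply: sumr_ge0 => k _; rewrite mulr_ge0.
rewrite -expectation_absZ// -(@expectation_ge0_sum c U)// -expectation_ge0D//.
apply: (le_trans (stein_bound_of_le (g := fun k => (k <= 0)%N%:R) (f := f) (M := 1)
  (W := fun w => W1 w + W2 w) _ _ _ _ _ _ _)) => //.
- by move=> k; exact: stein_eq.
- by case=> [|k]; [rewrite /= normr0|apply: (@stein_ind_le1 _ _ lam_gt0 _ _ _
  (@has_poisson_mean_cdf_test _ lam 0))].
- exact: measurable_funD.
- by move=> w; rewrite addr_ge0.
- apply: filterS ae_V_ge0 => w.
  case E : ((X w)%:Z + Z w) => [n|//] _.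
  have [Z0|/absZ_ge1 Z1] := eqVneq (Z w) 0.
    by rewrite -E no_jump// addr_ge0.
  rewrite -PoszD addn1 /=.
  have KE := sub_negpart E; set k0 := minn (X w) n in KE.
  have D : `|f (X w).+1 - f n.+1| <= f k0.+1.
    by apply: stein_cdf_dist => //; rewrite ?geq_minl ?geq_minr.
  apply: (le_trans (ler_wpM2l l0 D)).
  have [k0m|mk0] := ltnP k0 m.
    rewrite -[leLHS]add0r lerD//.
    apply: (@le_trans _ _ (c k0 * U k0 w)); last first.
      rewrite /W2 (bigD1_seq k0) ?mem_index_iota ?iota_uniq//= lerDl.
      by apply: sumr_ge0 => k _; rewrite mulr_ge0.
    rewrite /U indicE mem_set//= mulr1; apply: le_trans (stein_zero_le _ lam_gt0 k0) _.
    by rewrite -/(c k0); apply: ler_peMr.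
  rewrite -[leLHS]addr0 lerD//.
  apply: (@le_trans _ _ (m`!%:R / lam ^+ m)); last by rewrite ler_peMr.
  apply: (@le_trans _ _ (lam * f m.+1)); first by rewrite ler_pM2l// stein_cdf_noninc.
  by have := stein_zero_le _ lam_gt0 m; rewrite le_min => /andP[].
rewrite -addeA leeD2l// nneseries_recl//.
apply: leeD.
  rewrite -EFinM lee_fin mulrC ler_wpM2r// ger0_norm; first exact: stein_zero_first.
  exact: stein_cdf_ge0.
rewrite -nneseriesZl// -!(nneseries_addn 1); last 2 first.
- by move=> i; rewrite -EFinM lee_fin mulr_ge0// le_min ler01 invr_ge0 exprn_ge0.
- by move=> i; rewrite lee_fin mulr_ge0.
apply: lee_nneseries => [i _ _|i _]; first by rewrite lee_fin mulr_ge0.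
rewrite -EFinM lee_fin mulrC addn1 ler_wpM2r// ger0_norm; first exact: stein_zero_rest.
exact: stein_cdf_ge0.
Qed.

(** When [X - Z_- <= v] the increment is controlled by the step bound for
    indicators; otherwise both arguments lie beyond [v + 1], where the solution is
    decreasing and bounded by [stein_cdf_le]. *)
Lemma cdf_bound (v : nat) :
  (`|P [set w | (X w <= v)%N] - Q [set w | (Y w <= v)%N]|
    <= (v.+1%:R ^+ 2 / lam)%:E * 'E_P[fun w => `|(Z w)%:~R|%R]
       + 'E_P[fun w => (`|(Z w)%:~R| *
           \1_[set w | ((X w)%:Z - negpart (Z w) <= v%:Z)%R] w)%R]
       + (Num.min 1 (Num.sqrt lam)^-1)%:E
           * \sum_(0 <= i <oo) `|q i|%:E)%E.
Proof.
rewrite !(prob_preimage _ (fun k => (k <= v)%N)) -EFinB abse_EFin cdf_mean.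
pose f := stein lam (fun k => (k <= v)%N%:R) (poisson_cdf lam v).
have l0 := ltW lam_gt0.
have cv : 0 <= v.+1%:R ^+ 2 / lam by rewrite divr_ge0// exprn_ge0.
pose W1 w : R := v.+1%:R ^+ 2 / lam * `|(Z w)%:~R|.
pose W2 w : R := `|(Z w)%:~R| * \1_[set w | ((X w)%:Z - negpart (Z w) <= v%:Z)%R] w.
have mW1 : measurable_fun setT W1 by apply: measurable_funM => //; exact: measurable_absZ.
have mW2 : measurable_fun setT W2.
  by apply: measurable_absZ_indic; exact: (measurable_K [set z | (z <= v%:Z)%R]).
have W10 w : 0 <= W1 w by rewrite mulr_ge0.
have W20 w : 0 <= W2 w by rewrite mulr_ge0.
rewrite -expectation_absZ// -expectation_ge0D//.
apply: (le_trans (stein_bound_of_le (g := fun k => (k <= v)%N%:R) (f := f) (M := 1)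
  (W := fun w => W1 w + W2 w) _ _ _ _ _ _ _)) => //.
- by move=> k; exact: stein_eq.
- by case=> [|k]; [rewrite /= normr0|apply: (@stein_ind_le1 _ _ lam_gt0 _ _ _
  (@has_poisson_mean_cdf_test _ lam v))].
- exact: measurable_funD.
- by move=> w; rewrite addr_ge0.
- apply: filterS ae_V_ge0 => w V0.
  have [Z0|/absZ_ge1 Z1] := eqVneq (Z w) 0.
    by rewrite no_jump// addr_ge0.
  have [Kv|vK] := boolP ((X w)%:Z - negpart (Z w) <= v%:Z)%R.
    rewrite -[leLHS]add0r lerD// /W2 indicE mem_set//= mulr1.
    apply: (le_trans (@int_ext_scaled f 1 _ _ _ _)) => //; last by rewrite mul1r.
    move=> k; apply: (le_trans (@stein_ind_step _ _ lam_gt0 _ _ _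
      (@has_poisson_mean_cdf_test _ lam v))).
    by rewrite ge_min lexx.
  rewrite -[leLHS]addr0 lerD//.
  apply: (@le_trans _ _ (v.+1%:R ^+ 2 / lam)); last by rewrite ler_peMr.
  apply: le_trans (stein_cdf_le _ lam_gt0 v); rewrite ler_pM2l//.
  move: V0 vK; case E : ((X w)%:Z + Z w) => [n|//] _.
  rewrite (sub_negpart E) -PoszD addn1 /= => vK.
  by apply: stein_cdf_dist => //; lia.
rewrite leeD2l//; apply: (@series_bound (fun i => f i.+1)) => i.
exact: (@stein_ind_le _ _ lam_gt0 _ _ _ (@has_poisson_mean_cdf_test _ lam v)).
Qed.

End Nonneg.
End Bounds.

Local Open Scope ereal_scope.

Theorem theorem1p3
  (R : realType)
  (d : measure_display) (T : measurableType d) (P : probability T R)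
  (d' : measure_display) (T' : measurableType d') (Q : probability T' R)
  (lambda : R) (lambda_gt0 : (0 < lambda)%R)
  (X : {RV P >-> nat}) (Plambda : {RV Q >-> nat})
  (Plambda_poisson : is_poisson Q lambda Plambda)
  (Z : {RV P >-> int})
  (q : nat -> R)
  (q_def : forall i : nat, (1 <= i)%N ->
     (q i.-1)%:E = i%:R%:E * P [set w | X w = i]
       - lambda%:E * P [set w | ((X w)%:Z + Z w = i%:Z - 1)%R]) :
  [/\ dTV P X Q Plambda
        <= (Num.min 1 lambda)%:E * 'E_P[fun w => `|(Z w)%:~R|%R]
           + (Num.min 1 (Num.sqrt lambda)^-1)%:E * \sum_(0 <= i <oo) `|q i|%:E,
      dW P X Q Plambda
        <= lambda%:E * 'E_P[fun w => `|(Z w)%:~R|%R]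
           + \sum_(0 <= i <oo) `|q i|%:E
    & P [set w | (0 <= (X w)%:Z + Z w)%R] = 1 ->
      [/\ dW P X Q Plambda
            <= (Num.min (11437 / 10000 * Num.sqrt lambda) lambda)%:E
                 * 'E_P[fun w => `|(Z w)%:~R|%R]
               + \sum_(0 <= i <oo) `|q i|%:E,
          forall m : nat,
            `|P [set w | X w = 0%N] - Q [set w | Plambda w = 0%N]|
            <= (m`!%:R / lambda ^+ m)%:E * 'E_P[fun w => `|(Z w)%:~R|%R]
               + \sum_(0 <= k < m)
                   (Num.min (lambda / k.+1%:R) (k`!%:R / lambda ^+ k))%:E
                   * 'E_P[fun w => (`|(Z w)%:~R| *
                       \1_[set w | (X w)%:Z - negpart (Z w) = k%:Z] w)%R]
               + (Num.min 1 lambda^-1)%:E * `|q 0%N|%:E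
               + (Num.min 1 (lambda ^+ 2)^-1)%:E * \sum_(1 <= i <oo) `|q i|%:E
        & forall v : nat, (1 <= v)%N ->
            `|P [set w | (X w <= v)%N] - Q [set w | (Plambda w <= v)%N]|
            <= (v.+1%:R ^+ 2 / lambda)%:E * 'E_P[fun w => `|(Z w)%:~R|%R]
               + 'E_P[fun w => (`|(Z w)%:~R| *
                   \1_[set w | ((X w)%:Z - negpart (Z w) <= v%:Z)%R] w)%R]
               + (Num.min 1 (Num.sqrt lambda)^-1)%:E
                   * \sum_(0 <= i <oo) `|q i|%:E]].
Proof.
pose S := \sum_(0 <= i <oo) `|q i|%:E.
have EZ : 0 <= 'E_P[fun w => `|(Z w)%:~R|%R] by apply: expectation_ge0.
have S0 : 0 <= S by apply: nneseries_ge0 => i _ _; rewrite lee_fin.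
have sl : (0 < (Num.sqrt lambda)^-1)%R by rewrite invr_gt0 sqrtr_gt0.
have Sinf (x y : \bar R) (c : R) : S = +oo -> (0 < c)%R -> 0 <= y -> x <= y + c%:E * S.
  move=> -> c0 y0; rewrite gt0_muley ?lte_fin// addey ?leey//.
  by rewrite -ltNye (lt_le_trans _ y0).
have Sinf1 (x y : \bar R) : S = +oo -> 0 <= y -> x <= y + S.
  by move=> Soo y0; rewrite -[S]mul1e; exact: Sinf.
have c1 : (0 <= Num.min 1 lambda)%R by rewrite le_min ler01 ltW.
have c2 : (0 < Num.min 1 (Num.sqrt lambda)^-1)%R by rewrite lt_min ltr01.
(* If the series of the [|q i|] diverges, every right-hand side is infinite. *)
have fin_or : S = +oo \/ S < +oo.
  by have := leey S; rewrite le_eqVlt => /orP[/eqP|]; [left|right].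
split.
- apply: ge_ereal_sup => _ [A _ <-]; case: fin_or => [Soo|Sfin].
    by apply: Sinf => //; rewrite mule_ge0// lee_fin.
  have := event_bound lambda_gt0 q_def Plambda_poisson Sfin (fun k => `[< A k >]).
  have AE (U : Type) (Y : U -> nat) : [set w | `[< A (Y w) >]] = Y @^-1` A.
    by apply/seteqP; split => w /=; [move/asboolP|move=> ?; apply/asboolP].
  by rewrite /= !AE.
- apply: ge_ereal_sup => _ [g gLip <-]; case: fin_or => [Soo|Sfin].
    by apply: Sinf1 => //; rewrite mule_ge0// lee_fin ltW.
  exact: wasserstein_bound.
- move=> VP; split.
  + apply: ge_ereal_sup => _ [g gLip <-]; case: fin_or => [Soo|Sfin].
      have K0 : (0 <= 11437 / 10000 * Num.sqrt lambda)%R.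
        by apply: mulr_ge0; [lra|exact: sqrtr_ge0].
      apply: (Sinf1 _ _ Soo (mule_ge0 _ EZ)); rewrite lee_fin le_min K0 /=.
      exact: ltW.
    exact: wasserstein_bound_nonneg.
  + move=> m; case: fin_or => [Soo|Sfin].
      have S1 : \sum_(1 <= i <oo) `|q i|%:E = +oo.
        move: Soo; rewrite /S nneseries_recl//.
        have : 0 <= \sum_(1 <= i <oo) `|q i|%:E.
          by apply: nneseries_ge0 => i _ _; rewrite lee_fin.
        by case: (\sum_(1 <= i <oo) `|q i|%:E).
      have l0 := ltW lambda_gt0.
      rewrite S1 gt0_muley ?addey ?leey//; last first.
        by rewrite lte_fin lt_min ltr01 invr_gt0 exprn_gt0.
      rewrite -ltNye (@lt_le_trans _ _ 0)// !adde_ge0//.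
      - by rewrite mule_ge0// lee_fin divr_ge0// exprn_ge0.
      - apply: sume_ge0 => k _; rewrite mule_ge0//.
          by rewrite lee_fin le_min !divr_ge0// exprn_ge0.
        by apply: expectation_ge0 => w; rewrite mulr_ge0.
      - by rewrite -EFinM lee_fin mulr_ge0// le_min ler01 invr_ge0.
    have le0 (x : nat) : (x = 0%N) = (x <= 0)%N :> Prop.
      by rewrite leqn0; apply/propext; split => /eqP.
    have -> : [set w | X w = 0%N] = [set w | (X w <= 0)%N] by apply/funext => w; exact: le0.
    have -> : [set w | Plambda w = 0%N] = [set w | (Plambda w <= 0)%N]
      by apply/funext => w; exact: le0.
    exact: prob_zero_bound.
  + move=> v _; case: fin_or => [Soo|Sfin]; last exact: cdf_bound.
    apply: Sinf => //; rewrite adde_ge0 ?mule_ge0 ?lee_fin ?divr_ge0 ?exprn_ge0 ?(ltW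
      lambda_gt0)//.
    by apply: expectation_ge0 => w; rewrite mulr_ge0.
Qed.
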